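(* Let $1\leq p\leq\infty$ and let $X$, $Y$ be Banach spaces. A (bounded linear) operator $T:X\to Y^{*}$ corresponds, via $\Phi_T(x\otimes y)=\langle Tx,y\rangle$ for $x\in X$, $y\in Y$, to a bounded linear functional $\Phi_T$ on $X\hat{\otimes}_{\alpha_{p}}Y$ if and only if $T\in W_{p}^{mid}(X,Y^{*})$. In this case the norm of the bounded linear functional $\Phi_T\in (X\hat{\otimes}_{\alpha_{p}}Y)^{*}$ corresponding to $T$ equals $w_{p}^{mid}(T)$.
   Context: $X,Y,Z$ denote Banach spaces over $\mathbb{K}$ ($=\mathbb{R}$ or $\mathbb{C}$), $Z^{*}$ is the topological dual, $B_Z$ the closed unit ball, $\mathcal{L}(X,Z)$ the bounded linear operators. $p^{*}$ is the conjugate exponent of $p$. Sequence spaces. For $1\le p<\infty$: $\ell_p^w(Z)$ is the space of sequences $(z_j)_j$ in $Z$ with $\|(z_j)_j\|_p^w=\sup_{z^*\in B_{Z^*}}(\sum_j|z^*(z_j)|^p)^{1/p}<\infty$; $\ell_p^{mid}(Z)$ (mid $p$-summable sequences) is the space of sequences $(z_j)_j$ in $Z$ such that $\sum_n\sum_j|z_n^*(z_j)|^p<\infty$ for every $(z_n^* )_n\in\ell_p^w(Z^* )$, with norm $\|(z_j)_j\|_p^{mid}=\sup_{(z_n^* )_n\in B_{\ell_p^w(Z^* )}}(\sum_n\sum_j|z_n^*(z_j)|^p)^{1/p}$. For $p=\infty$, $\ell_\infty^w(Z)=\ell_\infty^{mid}(Z)=\ell_\infty(Z)$ (bounded sequences,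 sup norm). For $1\le p\le\infty$, $(\ell_p^{mid})^{dual}(Z)$ is the space of sequences $(z_j)_j$ in $Z$ with $\sum_j|z_j^*(z_j)|<\infty$ for all $(z_j^* )_j\in\ell_p^{mid}(Z^* )$, with norm $\|(z_j)_j\|_{p,mid}^{dual}=\sup_{(z_j^* )_j\in B_{\ell_p^{mid}(Z^* )}}\sum_j|z_j^*(z_j)|$. Finite sequences are regarded as infinite sequences extended by zeros. For $u\in X\otimes Y$, $\alpha_p(u)=\inf\{\|(x_j)_{j=1}^n\|_p^w\,\|(y_j)_{j=1}^n\|_{p,mid}^{dual}: u=\sum_{j=1}^n x_j\otimes y_j\}$. $X\hat\otimes_{\alpha_p}Y$ is the completion of $X\otimes_{\alpha_p} Y=(X\otimes Y,\alpha_p)$; a bounded linear functional on it is the same as a linear functional $\Phi$ on $X\otimes Y$ with $|\Phi(u)|\le C\alpha_p(u)$ for all $u\in X\otimes Y$ and some $C$, its norm being the least such $C$. A linear operator $T:X\to Z$ is weakly mid $p$-summing, $T\in W_p^{mid}(X,Z)$, if $\hat T:\ell_p^w(X)\to\ell_p^{mid}(Z)$, $\hat T((x_j)_j)=(Tx_j)_j$, is well defined and continuous. Its norm is $w_p^{mid}(T)=\|\hat T\|$; for $p<\infty$ this equals $\sup_{S\in B_{\mathcal{L}(Z,\ell_p)}}\pi_p(ST)$, where $\pi_p$ is the absolutely $p$-summing norm. *)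

(* Defs.v *)
From HB Require Import structures.
From mathcomp Require Import all_boot all_order all_algebra.
From mathcomp Require Import all_classical all_reals all_analysis.
From mathcomp Require Import complex.

Set Implicit Arguments.
Unset Strict Implicit.
Unset Printing Implicit Defensive.

Import Order.TTheory GRing.Theory Num.Theory.
Import numFieldNormedType.Exports.

Local Open Scope classical_set_scope.
Local Open Scope ring_scope.

Inductive scalars := RealScalars | ComplexScalars.

Definition scalar_field (R : realType) (k : scalars) : numFieldType :=
  match k with RealScalars => R | ComplexScalars => R[i] end.

(* Norms of normed modules over [scalar_field R k] take their values in the
   scalar field; [rpart] recovers the underlying real number and [ofreal] is
   the inclusion of the reals in the scalars. *)
Definition rpart (R : realType) (k : scalars) : scalar_field R k -> R :=
  match k with RealScalars => id | ComplexScalars => @complex.Re R end.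

Definition ofreal (R : realType) (k : scalars) : R -> scalar_field R k :=
  match k with RealScalars => id | ComplexScalars => real_complex R end.
Arguments ofreal {R} k.

Section ofreal_theory.
Variables (R : realType) (k : scalars).
Implicit Types a b : R.
Implicit Types c : scalar_field R k.

Lemma ofrealK : cancel (@ofreal R k) (@rpart R k).
Proof. by case: k => a. Qed.

Lemma rpartK c : 0 <= c -> ofreal k (rpart c) = c.
Proof.
move: k c => [] //= -[a b] /=.
by rewrite complex.lecE /= => /andP[/eqP -> _].
Qed.

Lemma ofrealD a b : ofreal k (a + b) = ofreal k a + ofreal k b.
Proof. by move: k => [] => //=; rewrite rmorphD. Qed.

Lemma ofrealM a b : ofreal k (a * b) = ofreal k a * ofreal k b.
Proof. by move: k => [] => //=; rewrite rmorphM. Qed.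

Lemma ofreal0 : ofreal k (0 : R) = 0.
Proof. by move: k => []. Qed.

Lemma ofreal1 : ofreal k (1 : R) = 1.
Proof. by move: k => []. Qed.

Lemma ler_ofreal a b : (ofreal k a <= ofreal k b) = (a <= b).
Proof. by move: k => [] => //=; rewrite complex.lecR. Qed.

End ofreal_theory.

Definition rnorm (R : realType) (k : scalars)
  (V : normedZmodType (scalar_field R k)) (x : V) : R := rpart `|x|.

Section rnorm_theory.
Variables (R : realType) (k : scalars).
Local Notation K := (scalar_field R k).

Lemma rnormE (V : normedZmodType K) (x : V) : ofreal k (rnorm x) = `|x|.
Proof. by rewrite rpartK. Qed.

Lemma rnorm_ge0 (V : normedZmodType K) (x : V) : 0 <= rnorm x.
Proof. by rewrite -(ler_ofreal k) rnormE ofreal0. Qed.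

Lemma ler_rnormD (V : normedZmodType K) (x y : V) :
  rnorm (x + y) <= rnorm x + rnorm y.
Proof. by rewrite -(ler_ofreal k) ofrealD !rnormE ler_normD. Qed.

Lemma rnorm0 (V : normedZmodType K) : rnorm (0 : V) = 0.
Proof. by rewrite /rnorm normr0 -(ofreal0 R k) ofrealK. Qed.

Lemma rnorm_eq0 (V : normedZmodType K) (x : V) : rnorm x = 0 -> x = 0.
Proof.
by move=> x0; apply/eqP; rewrite -normr_eq0 -rnormE x0 ofreal0.
Qed.

Lemma rnormZ (V : normedModType K) (c : K) (x : V) :
  rnorm (c *: x) = rnorm (c : K^o) * rnorm x.
Proof.
by apply: (can_inj (@ofrealK R k)); rewrite ofrealM !rnormE normrZ.
Qed.

End rnorm_theory.

Section dual.
Variables (R : realType) (k : scalars).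
Local Notation K := (scalar_field R k).
Variable X : normedModType K.

Definition is_dual (f : X -> K^o) : bool := `[< linear f /\ continuous f >].

Fact is_dual_submod : submod_closed (is_dual : {pred (X -> K^o)}).
Proof.
split=> [|a f g].
  apply/asboolP; split=> [c x y|]; first by rewrite scaler0 addr0.
  exact: cst_continuous.
move=> /asboolP[fl fc] /asboolP[gl gc]; apply/asboolP; split=> [c x y|x].
  rewrite -[LHS]/(a *: f (c *: x + y) + g (c *: x + y)) fl gl.
  rewrite -[RHS]/(c *: (a *: f x + g x) + (a *: f y + g y)).
  by rewrite !scalerDr !scalerA (mulrC a c) addrACA.
by apply: cvgD; [apply: cvgZr; exact: fc|exact: gc].
Qed.

HB.instance Definition _ :=
  GRing.isSubmodClosed.Build K (X -> K^o) is_dual is_dual_submod.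

Record dual := Dual { dual_fun :> X -> K^o; dualP : is_dual dual_fun }.

HB.instance Definition _ := [isSub for dual_fun].
HB.instance Definition _ := [Choice of dual by <:].
HB.instance Definition _ := [SubChoice_isSubLmodule of dual by <:].

Lemma dual_linear (f : dual) : linear f.
Proof. by case: f => f /= /asboolP[]. Qed.

Lemma dual_continuous (f : dual) : continuous f.
Proof. by case: f => f /= /asboolP[]. Qed.

HB.instance Definition _ (f : dual) :=
  GRing.isLinear.Build K X K^o *:%R f (dual_linear f).

Lemma dualD (f g : dual) x : (f + g) x = f x + g x. Proof. by []. Qed.
Lemma dualZ (c : K) (f : dual) x : (c *: f) x = c *: f x. Proof. by []. Qed.
Lemma dual0 x : (0 : dual) x = 0. Proof. by []. Qed.

Definition dual_norm_set (f : dual) : set R :=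
  [set rnorm (f x) | x in [set x : X | rnorm x <= 1]].

Definition dual_norm (f : dual) : R := sup (dual_norm_set f).

Lemma dual_norm_set_sup (f : dual) : has_sup (dual_norm_set f).
Proof.
split; first by exists (rnorm (f 0)), 0 => //=; rewrite rnorm0 ler01.
have /linear_boundedP[M [Mr fM]] :=
  @continuous_linear_bounded _ _ _ 0 f (@dual_continuous f 0).
have M1 : M < `|M| + 1.
  by rewrite (le_lt_trans (real_ler_norm Mr))// ltrDl ltr01.
have B0 : (0 : K) <= `|M| + 1 by rewrite addr_ge0.
exists (rpart (`|M| + 1)) => _ [x /= x1 <-].
rewrite -(ler_ofreal k) rnormE rpartK// (le_trans (fM _ M1 x))//.
by rewrite ler_piMr// -rnormE -(ofreal1 R k) ler_ofreal.
Qed.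

Lemma dual_norm_ub (f : dual) x : rnorm x <= 1 -> rnorm (f x) <= dual_norm f.
Proof. by move=> x1; apply: sup_upper_bound (dual_norm_set_sup f) _ _; exists x. Qed.

Lemma dual_norm_le (f : dual) (C : R) :
  (forall x, rnorm x <= 1 -> rnorm (f x) <= C) -> dual_norm f <= C.
Proof.
move=> fC; apply: ge_sup; first exact: (dual_norm_set_sup f).1.
by move=> _ [x x1 <-]; exact: fC.
Qed.

Lemma dual_norm_ge0 (f : dual) : 0 <= dual_norm f.
Proof.
by rewrite (le_trans (rnorm_ge0 (f 0)))// dual_norm_ub// rnorm0 ler01.
Qed.

Fact dual_normD (f g : dual) :
  ofreal k (dual_norm (f + g)) <= ofreal k (dual_norm f) + ofreal k (dual_norm g).
Proof.
rewrite -ofrealD ler_ofreal; apply: dual_norm_le => x x1.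
by rewrite dualD (le_trans (ler_rnormD _ _))// lerD// dual_norm_ub.
Qed.

Let dual_normZ_le (c : K) (f : dual) :
  dual_norm (c *: f) <= rnorm (c : K^o) * dual_norm f.
Proof.
apply: dual_norm_le => x x1.
by rewrite dualZ rnormZ ler_wpM2l ?rnorm_ge0// dual_norm_ub.
Qed.

Fact dual_normZ (c : K) (f : dual) :
  ofreal k (dual_norm (c *: f)) = `|c| * ofreal k (dual_norm f).
Proof.
rewrite -[`|c|](rnormE (c : K^o)) -ofrealM; congr ofreal.
apply/eqP; rewrite eq_le dual_normZ_le /=.
have [->|c0] := eqVneq c 0.
  by rewrite (rnorm0 (K^o : normedZmodType K)) mul0r dual_norm_ge0.
have cc : rnorm (c : K^o) * rnorm (c^-1 : K^o) = 1.
  have := rnormZ c (c^-1 : K^o); rewrite -[c *: _]/(c * c^-1) divff// => <-.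
  by rewrite /rnorm normr1 -(ofreal1 R k) ofrealK.
rewrite -[X in _ * dual_norm X <= _](scalerK c0 f).
apply: (le_trans (ler_wpM2l (rnorm_ge0 _) (dual_normZ_le _ _))).
by rewrite mulrA cc mul1r.
Qed.

Fact dual_norm_eq0 (f : dual) : ofreal k (dual_norm f) = 0 -> f = 0.
Proof.
rewrite -(ofreal0 R k) => /(can_inj (@ofrealK R k)) f0.
apply: val_inj; apply/funext => x /=; apply: (@rnorm_eq0 _ _ (K^o)).
have [->|x0] := eqVneq x 0; first by rewrite linear0 rnorm0.
have nx : `|x| != 0 by rewrite normr_eq0.
have : rnorm (f (`|x|^-1 *: x)) <= 0.
  rewrite -f0 dual_norm_ub// -(ler_ofreal k) rnormE ofreal1 normrZ normfV.
  by rewrite normr_id mulVf.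
rewrite linearZ rnormZ /= => fx; apply/eqP.
rewrite eq_le rnorm_ge0 andbT; move: fx; rewrite pmulr_rle0//.
rewrite lt_neqAle rnorm_ge0 andbT eq_sym; apply: contra nx => /eqP.
by move/(@rnorm_eq0 _ _ (K^o))/eqP; rewrite invr_eq0.
Qed.

HB.instance Definition _ :=
  Lmodule_isNormed.Build K dual dual_normD dual_normZ dual_norm_eq0.

End dual.

Lemma rnorm_dual (R : realType) (k : scalars)
  (X : normedModType (scalar_field R k)) (f : dual X) : rnorm f = dual_norm f.
Proof. exact: ofrealK. Qed.

(* The exponent p ranges over [1, +oo] in \bar R; the value for p = -oo is
   irrelevant.  All norms take values in [0, +oo]; [middual_norm] is the norm
   of (l_p^mid)^dual.  For p = +oo the weak and mid norms are by convention
   the sup norm. *)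
Section sequence_spaces.
Variables (R : realType) (k : scalars).
Local Notation K := (scalar_field R k).
Local Open Scope ereal_scope.

Definition sup_norm (Z : normedModType K) (z : nat -> Z) : \bar R :=
  ereal_sup (range (fun j => (rnorm (z j))%:E)).

Definition weak_norm (Z : normedModType K) (p : \bar R) (z : nat -> Z) : \bar R :=
  match p with
  | r%:E => ereal_sup
      [set (\sum_(0 <= j <oo) (rnorm (f (z j)) `^ r)%:E) `^ r^-1
         | f in [set f : dual Z | (rnorm f <= 1)%R]]
  | _ => sup_norm z
  end.

Definition in_lpw (Z : normedModType K) (p : \bar R) (z : nat -> Z) : Prop :=
  weak_norm p z < +oo.

Definition mid_sum (Z : normedModType K) (r : R) (f : nat -> dual Z)
    (z : nat -> Z) : \bar R :=
  \sum_(0 <= n <oo) \sum_(0 <= j <oo) (rnorm (f n (z j)) `^ r)%:E.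

Definition in_lpmid (Z : normedModType K) (p : \bar R) (z : nat -> Z) : Prop :=
  match p with
  | r%:E => forall f : nat -> dual Z, in_lpw p f -> mid_sum r f z < +oo
  | _ => sup_norm z < +oo
  end.

Definition mid_norm (Z : normedModType K) (p : \bar R) (z : nat -> Z) : \bar R :=
  match p with
  | r%:E => ereal_sup
      [set mid_sum r f z `^ r^-1
         | f in [set f : nat -> dual Z | weak_norm p f <= 1]]
  | _ => sup_norm z
  end.

Definition middual_norm (Z : normedModType K) (p : \bar R) (z : nat -> Z) : \bar R :=
  ereal_sup
    [set \sum_(0 <= j <oo) (rnorm (f j (z j)))%:E
       | f in [set f : nat -> dual Z | in_lpmid p f /\ mid_norm p f <= 1]].

End sequence_spaces.

Section weakly_mid_summing.
Variables (R : realType) (k : scalars).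
Local Notation K := (scalar_field R k).
Variables (X Z : normedModType K) (p : \bar R) (T : {linear X -> Z}).
Local Open Scope ereal_scope.

Definition weakly_mid_summing : Prop :=
  (forall x : nat -> X, in_lpw p x -> in_lpmid p (T \o x)) /\
  (forall x : nat -> X, in_lpw p x -> forall e : R, (0 < e)%R ->
     exists2 d : R, (0 < d)%R &
       forall x' : nat -> X, in_lpw p x' ->
         weak_norm p (fun j => x' j - x j)%R < d%:E ->
         mid_norm p (fun j => T (x' j) - T (x j))%R < e%:E).

Definition wmid_norm : \bar R :=
  ereal_sup [set mid_norm p (T \o x)
               | x in [set x : nat -> X | weak_norm p x <= 1]].

End weakly_mid_summing.

Section tensor_product.
Variables (R : realType) (k : scalars).
Local Notation K := (scalar_field R k).
Variables X Y : lmodType K.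

Definition evaluation (x : X) (y : Y) : {bilinear X -> Y -> K^o} -> K^o :=
  fun B => B x y.

Definition is_tensor (u : {bilinear X -> Y -> K^o} -> K^o) : bool :=
  `[< exists s : seq (X * Y), u = \sum_(q <- s) evaluation q.1 q.2 >].

Fact is_tensor_submod :
  submod_closed (is_tensor : {pred ({bilinear X -> Y -> K^o} -> K^o)}).
Proof.
split=> [|a u v]; first by apply/asboolP; exists [::]; rewrite big_nil.
move=> /asboolP[s ->] /asboolP[t ->]; apply/asboolP.
exists ([seq (a *: q.1, q.2) | q <- s] ++ t).
rewrite big_cat big_map scaler_sumr /=; congr (_ + _).
apply: eq_bigr => q _; apply/funext => B.
by rewrite -[LHS]/(a *: B q.1 q.2) /evaluation /= linearZl_LR.
Qed.

HB.instance Definition _ := GRing.isSubmodClosed.Build K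
  ({bilinear X -> Y -> K^o} -> K^o) is_tensor is_tensor_submod.

(* The algebraic tensor product, realised as the span of the evaluations
   x (x) y : B |-> B(x, y) in the algebraic dual of the space of all bilinear
   forms on X x Y; see [tensor_liftE] and [tensor_ext] for its universal
   property. *)
Record tensor := Tensor {
  tensor_fun :> {bilinear X -> Y -> K^o} -> K^o;
  tensorP : is_tensor tensor_fun }.

HB.instance Definition _ := [isSub for tensor_fun].
HB.instance Definition _ := [Choice of tensor by <:].
HB.instance Definition _ := [SubChoice_isSubLmodule of tensor by <:].

Fact is_tensor_evaluation x y : is_tensor (evaluation x y).
Proof. by apply/asboolP; exists [:: (x, y)]; rewrite big_seq1. Qed.

Definition elementary (x : X) (y : Y) : tensor :=
  Tensor (is_tensor_evaluation x y).

Lemma tensor_spanned (u : tensor) :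
  exists s : seq (X * Y), u = \sum_(q <- s) elementary q.1 q.2.
Proof.
have /asboolP[s us] := tensorP u; exists s.
apply: val_inj => /=; rewrite us; elim: s {us} => [|q s IH].
  by rewrite !big_nil.
by rewrite !big_cons IH.
Qed.

Definition tensor_lift (B : {bilinear X -> Y -> K^o}) (u : tensor) : K^o := u B.

Fact tensor_lift_linear B : linear (tensor_lift B).
Proof. by []. Qed.

HB.instance Definition _ B :=
  GRing.isLinear.Build K tensor K^o *:%R (tensor_lift B) (tensor_lift_linear B).

Lemma tensor_liftE B x y : tensor_lift B (elementary x y) = B x y.
Proof. by []. Qed.

Lemma tensor_ext (F G : {linear tensor -> K^o}) :
  (forall x y, F (elementary x y) = G (elementary x y)) -> F =1 G.
Proof.
move=> FG u; have [s ->] := tensor_spanned u.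
by rewrite !linear_sum; apply: eq_bigr => q _; exact: FG.
Qed.

End tensor_product.

Section alpha.
Variables (R : realType) (k : scalars).
Local Notation K := (scalar_field R k).
Variables (X Y : normedModType K) (p : \bar R).
Local Open Scope ereal_scope.

Definition alpha (u : tensor X Y) : \bar R :=
  ereal_inf
    [set weak_norm p (fun j => nth 0%R (map fst s) j) *
         middual_norm p (fun j => nth 0%R (map snd s) j)
       | s in [set s : seq (X * Y) |
                 u = (\sum_(q <- s) elementary q.1 q.2)%R]].

Definition alpha_bound (Phi : {linear tensor X Y -> K^o}) (C : R) : Prop :=
  (0 <= C)%R /\ forall u, (rnorm (Phi u))%:E <= C%:E * alpha u.

(* Phi extends to a bounded linear functional on the completion of
   (X (x) Y, alpha_p). *)
Definition alpha_bounded (Phi : {linear tensor X Y -> K^o}) : Prop :=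
  exists C : R, alpha_bound Phi C.

Definition alpha_dual_norm (Phi : {linear tensor X Y -> K^o}) : \bar R :=
  ereal_inf [set C%:E | C in alpha_bound Phi].

End alpha.

Section functional_of.
Variables (R : realType) (k : scalars).
Local Notation K := (scalar_field R k).
Variables (X Y : normedModType K) (T : {linear X -> dual Y}).

Definition pairing (x : X) (y : Y) : K^o := T x y.

Fact pairing_bilinear : bilinear_for *:%R *:%R pairing.
Proof.
by split=> [y a x x'|x a y y']; rewrite /pairing linearP.
Qed.

HB.instance Definition _ :=
  bilinear_isBilinear.Build K X Y K^o *:%R *:%R pairing pairing_bilinear.

(* Phi_T, on the algebraic tensor product; it is not assumed bounded. *)
Definition functional_of : {linear tensor X Y -> K^o} := tensor_lift pairing.

Lemma functional_ofE x y : functional_of (elementary x y) = T x y.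
Proof. by []. Qed.

End functional_of.

(* Main.v *)
(* The core is a duality for tuples: for finitely many [psi i] in Y* and [f i]
   in Y**, if |sum psi_i(y_i)| <= M * (weak l_r norm of y) for all tuples y in Y,
   then |sum f_i(psi_i)| <= M * (weak l_r norm of f). It replaces the principle of
   local reflexivity: a finite family of functionals norming l_r^n up to a factor
   1 - d embeds the weak l_r tuples of Y in a finite l_oo-sum of copies of Y, so
   that Hahn-Banach writes psi_i = sum_j a_ji g_j with sum_j |g_j| <= M / (1 - d),
   and then sum_i f_i(psi_i) = sum_j (sum_i a_ji f_i)(g_j).

   If [functional_of T] is alpha_p-bounded by C, choose lambda in the unit ball
   of the dual of l_p so that sum_ij lambda_ij f_i(T x_j) is the l_p norm of the
   finite array f_i(T x_j), and apply the duality to psi_i = sum_j lambda_ij T x_j: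
   on tuples y, sum_i psi_i(y_i) is the value of the functional at
   sum_j x_j (x) (sum_i lambda_ij y_i), whose second factors have dual mid norm at
   most the weak norm of y. Conversely, the bound on mid norms gives the bound on
   each representation of a tensor by homogeneity and the definition of the dual
   mid norm. *)
Require Import Defs.
From HB Require Import structures.
From mathcomp Require Import all_boot all_order all_algebra.
From mathcomp Require Import all_classical all_reals all_analysis.
From mathcomp Require Import complex lra ring.

Set Implicit Arguments.
Unset Strict Implicit.
Unset Printing Implicit Defensive.

Import Order.TTheory GRing.Theory Num.Theory.
Import numFieldNormedType.Exports.

Local Open Scope classical_set_scope.
Local Open Scope ring_scope.

(** * Hahn-Banach extension *)

Section sublinear.
Variables (R : realType) (V : lmodType R).
Implicit Types (q p : V -> R) (S : set (V * R)).

Definition sublinear q :=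
  (forall x y, q (x + y) <= q x + q y) /\
  (forall (t : R) x, 0 <= t -> q (t *: x) = t * q x).

Lemma sublinear0 q : sublinear q -> q 0 = 0.
Proof. by move=> [_ qZ]; have := qZ 0 0 (lexx _); rewrite scale0r mul0r. Qed.

Lemma sublinear_geN q x : sublinear q -> - q (- x) <= q x.
Proof.
move=> sq; have := sq.1 x (- x); rewrite subrr (sublinear0 sq).
by rewrite -lerBlDr sub0r.
Qed.

(** A pair [(v, c)] in the cone encodes the demand that the functional under construction be at
    least [c] at [v]. *)
Definition convex_cone S :=
  [/\ S (0, 0), (forall a b, S a -> S b -> S (a.1 + b.1, a.2 + b.2)) &
      (forall (t : R) a, 0 < t -> S a -> S (t *: a.1, t * a.2))].

(** For a cone [S] dominated by [q], this is the largest sublinear function below [q] whose value at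
    [- a.1] is at most [- a.2] for all [a] in [S]; a linear functional below it meets every demand
    of [S]. *)
Definition cone_inf q S v := inf [set q (v + a.1) - a.2 | a in S].

Variables (q : V -> R) (S : set (V * R)).
Hypotheses (sq : sublinear q) (cS : convex_cone S).
Hypothesis qS : forall a, S a -> a.2 <= q a.1.

Let has_inf_cone v : has_inf [set q (v + a.1) - a.2 | a in S].
Proof.
have [S0 _ _] := cS.
split; first by exists (q (v + 0) - 0), (0, 0).
(* The lower bound comes from [a.2 <= q a.1 <= q (v + a.1) + q (- v)]. *)
exists (- q (- v)) => _ [a Sa <-]; have := qS Sa.
have := sq.1 (v + a.1) (- v); rewrite addrAC subrr add0r; lra.
Qed.

Lemma cone_inf_ub v a : S a -> cone_inf q S v <= q (v + a.1) - a.2.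
Proof. by move=> Sa; apply: ge_inf; [exact: (has_inf_cone v).2|exists a]. Qed.

Lemma cone_inf_le v : cone_inf q S v <= q v.
Proof. by have [S0 _ _] := cS; have /= := cone_inf_ub v S0; rewrite addr0 subr0. Qed.

Lemma cone_infN a : S a -> cone_inf q S (- a.1) <= - a.2.
Proof.
by move=> /(cone_inf_ub (- a.1)); rewrite addNr (sublinear0 sq) sub0r.
Qed.

Let cone_inf_glb v c : (forall a, S a -> c <= q (v + a.1) - a.2) -> c <= cone_inf q S v.
Proof.
move=> h; apply: lb_le_inf; first exact: (has_inf_cone v).1.
by move=> _ [a Sa <-]; exact: h.
Qed.

(** Stability of [S] under sums gives subadditivity, stability under positive dilations gives
    homogeneity; at the scalar 0 the domination [qS] is what keeps the infimum from being
    negative. *)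
Lemma cone_inf_sublinear : sublinear (cone_inf q S).
Proof.
have [S0 SD SZ] := cS.
have leZ t x : 0 < t -> cone_inf q S (t *: x) <= t * cone_inf q S x.
  move=> t0; rewrite -ler_pdivrMl//; apply: cone_inf_glb => a Sa.
  rewrite ler_pdivrMl// mulrBr -(sq.2 _ _ (ltW t0)) scalerDr.
  exact: (cone_inf_ub (t *: x) (SZ _ _ t0 Sa)).
split=> [x y|t x].
  rewrite -lerBlDr; apply: cone_inf_glb => a Sa; rewrite lerBlDl -lerBlDr.
  apply: cone_inf_glb => b Sb; rewrite lerBlDl.
  apply: le_trans (cone_inf_ub _ (SD _ _ Sa Sb)) _ => /=; rewrite addrACA.
  have := sq.1 (x + a.1) (y + b.1); lra.
rewrite le_eqVlt => /predU1P[<-|t0].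
  rewrite scale0r mul0r; apply/eqP; rewrite eq_le.
  have := cone_inf_le 0; rewrite (sublinear0 sq) => -> /=.
  by apply: cone_inf_glb => a Sa; rewrite add0r subr_ge0 qS.
apply/eqP; rewrite eq_le leZ//= -ler_pdivlMl//.
by have := leZ t^-1 (t *: x); rewrite scalerA mulVf ?gt_eqF// scale1r invr_gt0; exact.
Qed.

End sublinear.

Section minorant.
Variables (R : realType) (V : lmodType R) (q : V -> R).
Hypothesis sq : sublinear q.

Let T := {p : V -> R | sublinear p /\ forall x, p x <= q x}.
(** The order is reversed, so that the maximal elements of Zorn's lemma are the minimal
    minorants. *)
Let rle (p p' : T) : bool := `[< forall x, sval p' x <= sval p x >].

Let top : T := exist _ q (conj sq (fun x => lexx (q x))).

(** The bound is the pointwise infimum of the chain. Of two members the smaller one serves both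
    points, so subadditivity survives. *)
Let chain_bound (A : set T) : total_on A rle -> exists t, forall s, A s -> rle s t.
Proof.
(* Adjoining [top] makes the infima range over nonempty sets even for the empty chain, and keeps
   them below [q]. *)
move=> totA; pose B := top |` A.
have totB s t : B s -> B t -> rle s t \/ rle t s.
  move=> [->|As] [->|At]; last exact: totA.
  - by left; apply/asboolP.
  - by left; apply/asboolP => x; exact: (svalP t).2.
  - by right; apply/asboolP => x; exact: (svalP s).2.
pose E x := [set sval p x | p in B].
have infE x : has_inf (E x).
  split; first by exists (q x), top => //; left.
  exists (- q (- x)) => _ [p _ <-]; apply: le_trans (sublinear_geN _ (svalP p).1).
  by rewrite lerN2 (svalP p).2.
have inf_ub p x : B p -> inf (E x) <= sval p x.
  by move=> Bp; apply: ge_inf; [exact: (infE x).2|exists p].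
have inf_glb x c : (forall p, B p -> c <= sval p x) -> c <= inf (E x).
  move=> h; apply: lb_le_inf; first exact: (infE x).1.
  by move=> _ [p Bp <-]; exact: h.
have subE : sublinear (fun x => inf (E x)).
  split=> [x y|t x].
    rewrite -lerBlDr; apply/inf_glb => p Bp; rewrite lerBlDl -lerBlDr.
    apply/inf_glb => p' Bp'; rewrite lerBlDl.
    have [/asboolP pp'|/asboolP pp'] := totB _ _ Bp Bp'.
      have := inf_ub _ (x + y) Bp'; have := (svalP p').1.1 x y; have := pp' x; lra.
    have := inf_ub _ (x + y) Bp; have := (svalP p).1.1 x y; have := pp' y; lra.
  rewrite le_eqVlt => /predU1P[<-|t0].
    rewrite scale0r mul0r; apply/eqP; rewrite eq_le.
    have /= := inf_ub top 0 (or_introl erefl); rewrite (sublinear0 sq) => -> /=.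
    by apply/inf_glb => p Bp; rewrite (sublinear0 (svalP p).1).
  apply/eqP; rewrite eq_le; apply/andP; split.
    rewrite -ler_pdivrMl//; apply/inf_glb => p Bp.
    by rewrite ler_pdivrMl// -((svalP p).1.2 _ _ (ltW t0)) inf_ub.
  apply/inf_glb => p Bp.
  by rewrite ((svalP p).1.2 _ _ (ltW t0)) ler_pM2l// inf_ub.
pose b : T :=
  exist _ (fun x => inf (E x)) (conj subE (fun x => inf_ub top x (or_introl erefl))).
exists b => s As; by apply/asboolP => x /=; apply/inf_ub; right.
Qed.

(* A minimal sublinear minorant is linear: lowering it along a ray by
   [cone_inf] does not change it. *)
Lemma linear_minorant : exists F : {linear V -> R^o}, forall x, F x <= q x.
Proof.
have [| | |[p [sp pq]] pmin] := @ZL_preorder T top rle.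
- by move=> t; apply/asboolP.
- move=> r s t /asboolP rs /asboolP st; apply/asboolP => x.
  exact: le_trans (st x) (rs x).
- exact: chain_bound.
have pN x : p (- x) = - p x.
  (* On the ray through [(x, p x)] the lowered function is at most [- p x] at [- x], and minimality
     puts [p] below it. *)
  pose S : set (V * R) := [set (t *: x, t * p x) | t in [set t | 0 <= t]].
  have cS : convex_cone S.
    split; first by exists 0; rewrite /= ?scale0r ?mul0r.
      move=> _ _ [t /= t0 <-] [s /= s0 <-] /=; exists (t + s) => /=.
        exact: addr_ge0.
      by rewrite scalerDl mulrDl.
    move=> t _ t0 [s /= s0 <-] /=; exists (t * s) => /=.
      by rewrite mulr_ge0// ltW.
    by rewrite scalerA mulrA.
  have pS a : S a -> a.2 <= p a.1 by move=> [t /= t0 <-] /=; rewrite sp.2.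
  have sS := cone_inf_sublinear sp cS pS.
  have leS y : cone_inf p S y <= q y.
    exact: le_trans (cone_inf_le sp cS pS y) (pq y).
  pose b : T := exist _ (cone_inf p S) (conj sS leS).
  have /asboolP/= pS' : rle b (exist _ p (conj sp pq)).
    by apply: pmin; apply/asboolP => y /=; exact: cone_inf_le.
  apply/eqP; rewrite eq_le; apply/andP; split.
    apply: le_trans (pS' _) _.
    by apply: (cone_infN sp cS pS (a := (x, p x))); exists 1; rewrite /= ?ler01// scale1r mul1r.
  by have := sublinear_geN (- x) sp; rewrite opprK.
have pD x y : p (x + y) = p x + p y.
  apply/eqP; rewrite eq_le sp.1/=.
  by have := sp.1 (x + y) (- y); rewrite addrK pN lerBrDr.
have pZ (t : R) x : p (t *: x) = t * p x.
  have [t0|t0] := leP 0 t; first exact: sp.2.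
  by rewrite -[t]opprK scaleNr pN sp.2 ?mulNr// oppr_ge0 ltW.
have pl : linear (p : V -> R^o) by move=> t x y; rewrite pD pZ.
pose F : {linear V -> R^o} := HB.pack (p : V -> R^o) (GRing.isLinear.Build _ _ _ _ _ pl).
by exists F.
Qed.

End minorant.

(** The domination by [q] forces [psi] to vanish on the kernel of [A], so this extends a functional
    from the image of [A]. The cone is the graph of [psi] along [A]; being stable under negation, it
    turns the demanded inequality into an equality. *)
Lemma sublinear_extension (R : realType) (U V : lmodType R) (q : V -> R)
    (A : {linear U -> V}) (psi : {linear U -> R^o}) :
  sublinear q -> (forall u, psi u <= q (A u)) ->
  exists F : {linear V -> R^o},
    (forall v, F v <= q v) /\ forall u, F (A u) = psi u.
Proof.
move=> sq psiq; pose S : set (V * R) := [set (A u, psi u) | u in setT].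
have cS : convex_cone S.
  split; first by exists 0; rewrite ?linear0.
    by move=> _ _ [u _ <-] [v _ <-]; exists (u + v); rewrite ?linearD.
  by move=> t _ _ [u _ <-]; exists (t *: u); rewrite ?linearZ.
have qS a : S a -> a.2 <= q a.1 by move=> [u _ <-]; exact: psiq.
have [F Fq] := linear_minorant (cone_inf_sublinear sq cS qS).
have Fpsi u : psi u <= F (A u).
  have : F (- A u) <= - psi u.
    apply: le_trans (Fq _) _.
    by apply: (cone_infN sq cS qS (a := (A u, psi u))); exists u.
  by rewrite linearN lerN2.
exists F; split=> [v|u]; first exact: le_trans (Fq v) (cone_inf_le sq cS qS v).
apply/eqP; rewrite eq_le Fpsi andbT.
by have := Fpsi (- u); rewrite !linearN lerN2.
Qed.

(** * Passage from real to complex scalars *)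

Section realify.
Variables (R : realType) (V : lmodType R[i]).

(** A separate name for [V], so that restriction of scalars can carry its own module structure. *)
Definition realify : Type := V.

HB.instance Definition _ := GRing.Zmodule.on realify.

Let rscale (a : R) (v : realify) : realify := (a%:C)%C *: (v : V).

Let rscaleA a b v : rscale a (rscale b v) = rscale (a * b) v.
Proof. by rewrite /rscale scalerA rmorphM. Qed.

Let rscale1 : left_id 1 rscale.
Proof. by move=> v; rewrite /rscale rmorph1 scale1r. Qed.

Let rscaleDr : right_distributive rscale +%R.
Proof. by move=> a u v; rewrite /rscale scalerDr. Qed.

Let rscaleDl v : {morph rscale^~ v : a b / a + b}.
Proof. by move=> a b; rewrite /rscale rmorphD scalerDl. Qed.

HB.instance Definition _ := GRing.Zmodule_isLmodule.Build R realify
  rscaleA rscale1 rscaleDr rscaleDl.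

Lemma realify_scaleE (a : R) (v : V) : a *: (v : realify) = (a%:C)%C *: v.
Proof. by []. Qed.

End realify.

Section seminorm_extension.
Variables (R : realType) (k : scalars).
Local Notation K := (scalar_field R k).

Definition seminorm (V : lmodType K) (q : V -> R) :=
  (forall x y, q (x + y) <= q x + q y) /\
  (forall (c : K) x, q (c *: x) = rnorm (c : K^o) * q x).

End seminorm_extension.

Section extension_real.
Variables (R : realType) (U V : lmodType R) (q : V -> R).
Variables (A : {linear U -> V}) (psi : {linear U -> R^o}).

Lemma seminorm_extension_real :
  @seminorm R RealScalars V q -> (forall u, `|psi u| <= q (A u)) ->
  exists F : {linear V -> R^o},
    (forall v, `|F v| <= q v) /\ forall u, F (A u) = psi u.
Proof.
move=> [qD qZ] psiq.
have sq : sublinear q.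
  by split=> // t x t0; rewrite qZ /rnorm /= ger0_norm.
have [|F [Fq FA]] := sublinear_extension (A := A) (psi := psi) sq.
  by move=> u; exact: le_trans (ler_norm _) (psiq u).
exists F; split=> // v; rewrite ler_norml Fq andbT lerNl -linearN.
apply: le_trans (Fq _) _.
by rewrite -scaleN1r qZ /rnorm /= normrN1 mul1r.
Qed.

End extension_real.

Section extension_complex.
Variables (R : realType) (U V : lmodType R[i]) (q : V -> R).
Variables (A : {linear U -> V}) (psi : {linear U -> R[i]^o}).
Local Notation Re := complex.Re.

(** The real part of [psi] is extended over the reals and completed to a complex functional;
    rotating [v] until its value is real and nonnegative turns the bound on the real part into one
    on the modulus. *)
Lemma seminorm_extension_complex :
  @seminorm R ComplexScalars V q -> (forall u, Re `|psi u| <= q (A u)) ->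
  exists F : {linear V -> R[i]^o},
    (forall v, Re `|F v| <= q v) /\ forall u, F (A u) = psi u.
Proof.
move=> [qD qZ] psiq.
have sq : sublinear (q : realify V -> R).
  split=> // t x t0; rewrite realify_scaleE qZ /rnorm /=; congr (_ * _).
  by rewrite expr0n addr0 sqrtr_sqr ger0_norm.
have Al : linear (A : realify U -> realify V).
  by move=> t x y; rewrite !realify_scaleE linearP.
pose A' : {linear realify U -> realify V} := HB.pack (A : realify U -> realify V)
  (GRing.isLinear.Build _ _ _ _ _ Al).
have pl : linear ((fun u => Re (psi u)) : realify U -> R^o).
  move=> t x y; rewrite realify_scaleE linearP /=.
  by case: (psi x) (psi y) => [a b] [c d] /=; rewrite mul0r subr0.
pose psi' : {linear realify U -> R^o} := HB.pack (_ : realify U -> R^o)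
  (GRing.isLinear.Build _ _ _ _ _ pl).
have Re_le (z : R[i]) : Re z <= Re `|z|.
  case: z => a b; rewrite normc_def /=; apply: le_trans (ler_norm a) _.
  by rewrite -sqrtr_sqr ler_wsqrtr// lerDl sqr_ge0.
have [|F [Fq FA]] := sublinear_extension (A := A') (psi := psi') sq.
  by move=> u; exact: le_trans (Re_le _) (psiq u).
(* A complex linear functional is determined by its real part [F], its imaginary part at [v] being
   [- F (i v)]. *)
pose G (v : V) : R[i]^o := (F v +i* - F ('i%C *: v))%C.
have FZ (a : R) (v : V) : F ((a%:C)%C *: v) = a * F v.
  by rewrite -realify_scaleE linearZ.
have FD (u v : V) : F (u + v) = F u + F v by rewrite linearD.
have FN (v : V) : F (- v) = - F v by rewrite linearN.
have Gl : linear G.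
  have ab (a b : R) : (a +i* b)%C = (a%:C + 'i * b%:C)%C.
    by apply/eqP; rewrite eq_complex /=; apply/andP; split; apply/eqP; ring.
  move=> [a b] x y; apply/eqP; rewrite eq_complex /G /=.
  have e1 : F ((a +i* b)%C *: x) = a * F x + b * F ('i%C *: x).
    by rewrite ab scalerDl FD FZ ['i%C * _]mulrC -scalerA FZ.
  have e2 : F ('i%C *: ((a +i* b)%C *: x)) = a * F ('i%C *: x) - b * F x.
    have -> : 'i%C *: ((a +i* b)%C *: x) = (a%:C)%C *: ('i%C *: x) - (b%:C)%C *: x.
      rewrite !scalerA -scalerBl; congr (_ *: _).
      by apply/eqP; rewrite eq_complex /=; apply/andP; split; apply/eqP; ring.
    by rewrite FD FN !FZ.
  by rewrite scalerDr !FD e1 e2; apply/andP; split; apply/eqP; ring.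
pose H : {linear V -> R[i]^o} := HB.pack (G : V -> R[i]^o)
  (GRing.isLinear.Build _ _ _ _ _ Gl).
exists H; split=> [v|u].
  have [->|Hv0] := eqVneq (H v) 0.
    rewrite normr0 /=.
    (* A seminorm is nonnegative, since [0 = q 0 <= q v + q (- v) = 2 * q v]. *)
    have := qZ 0 v; rewrite scale0r [rnorm _]rnorm0 mul0r => q0.
    have := qD v (- v); rewrite subrr q0 -scaleN1r qZ /rnorm normrN1 /=; lra.
  pose c := `|H v| / H v.
  have c1 : `|c| = 1 by rewrite normrM normfV normr_id mulfV// normr_eq0.
  have : F (c *: v) <= q (c *: v) by exact: Fq.
  rewrite qZ /rnorm c1 mul1r; apply: le_trans.
  have -> : F (c *: v) = Re (H (c *: v)) by [].
  by have -> : H (c *: v) = `|H v| by rewrite linearZ; exact: divfK.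
rewrite [LHS]/(G _) /G -linearZ !FA /= linearZ /=.
by case: (psi u) => a b; apply/eqP; rewrite eq_complex /= eqxx /= mul0r mul1r sub0r opprK.
Qed.

End extension_complex.

Lemma seminorm_extension (R : realType) (k : scalars)
    (U V : lmodType (scalar_field R k)) (q : V -> R)
    (A : {linear U -> V}) (psi : {linear U -> (scalar_field R k)^o}) :
  seminorm q -> (forall u, rnorm (psi u) <= q (A u)) ->
  exists F : {linear V -> (scalar_field R k)^o},
    (forall v, rnorm (F v) <= q v) /\ forall u, F (A u) = psi u.
Proof.
case: k U V q A psi => U V q A psi.
- exact: seminorm_extension_real.
- exact: seminorm_extension_complex.
Qed.

(** * Norming functionals of finite l_r spaces *)

Section finite_norm.
Variables (R : realType) (r : R) (r1 : 1 <= r) (I : finType).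
Implicit Types b t : I -> R.

Let r0 : 0 < r. Proof. exact: lt_le_trans ltr01 r1. Qed.

(** Young's inequality for the exponents [r / (r - 1)] and [r], written without the conjugate
    exponent so that it also covers [r = 1]. *)
Lemma young_powR (x y : R) : 0 <= x -> 0 <= y ->
  x `^ (r - 1) * y <= (1 - r^-1) * x `^ r + r^-1 * y `^ r.
Proof.
move=> x0 y0; have [r_eq1|rn1] := eqVneq r 1.
  by rewrite r_eq1 subrr powRr0 invr1 subrr mul0r add0r !mul1r powRr1.
have r1' : 0 < r - 1 by rewrite subr_gt0 lt_neqAle eq_sym rn1.
have q0 : 0 < r / (r - 1) by exact: divr_gt0.
have rn0 := lt0r_neq0 r0; have r1n0 := lt0r_neq0 r1'.
have := conjugate_powR (powR_ge0 x (r - 1)) y0 q0 r0.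
rewrite -powRrM mulrCA divff// mulr1 => /(_ _)/le_trans; apply.
  by field; rewrite rn0 r1n0.
have -> : x `^ r / (r / (r - 1)) = (1 - r^-1) * x `^ r.
  by field; rewrite rn0 r1n0.
by rewrite lerD2l mulrC.
Qed.

Definition lpnorm b : R := (\sum_i b i `^ r) `^ r^-1.

Lemma lpnorm_ge0 b : 0 <= lpnorm b. Proof. exact: powR_ge0. Qed.

Lemma lpnorm_powR b : lpnorm b `^ r = \sum_i b i `^ r.
Proof.
by rewrite -powRrM mulVf ?gt_eqF// powRr1// sumr_ge0// => i _; exact: powR_ge0.
Qed.

Lemma lpnorm_eq0 b i : lpnorm b = 0 -> b i = 0.
Proof.
move=> b0; have := lpnorm_powR b; rewrite b0 powR0 ?gt_eqF// => /esym/eqP.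
rewrite psumr_eq0 => [/allP/(_ i)|j _]; last exact: powR_ge0.
by rewrite mem_index_enum powR_eq0 => /(_ isT)/andP[/eqP].
Qed.

Lemma lpnorm_le b (B : R) : 0 <= B ->
  (lpnorm b <= B) = (\sum_i b i `^ r <= B `^ r).
Proof.
move=> B0; rewrite -lpnorm_powR; apply/idP/idP => [|h].
  by move=> h; apply: ge0_ler_powR; rewrite ?nnegrE ?lpnorm_ge0// ltW.
have : (lpnorm b `^ r) `^ r^-1 <= (B `^ r) `^ r^-1.
  by apply: ge0_ler_powR; rewrite ?nnegrE ?powR_ge0// invr_ge0 ltW.
by rewrite -[leLHS]powRrM -[leRHS]powRrM divff ?gt_eqF// !powRr1// lpnorm_ge0.
Qed.

Lemma ler_lpnorm b t : (forall i, 0 <= b i <= t i) -> lpnorm b <= lpnorm t.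
Proof.
move=> bt; rewrite lpnorm_le ?lpnorm_ge0// lpnorm_powR; apply: ler_sum => i _.
have /andP[b0 bti] := bt i; apply: ge0_ler_powR => //; rewrite ?nnegrE ?(ltW r0)//.
exact: le_trans bti.
Qed.

(** The weights [(b i / lpnorm b) ^ (r - 1)] are the equality case of Hölder's inequality; the bound
    against [t] is Young's inequality summed after normalising both [b] and [t]. *)
Lemma lpnorm_norming b : (forall i, 0 <= b i) ->
  exists w : I -> R, [/\ forall i, 0 <= w i, \sum_i w i * b i = lpnorm b &
    forall t, (forall i, 0 <= t i) -> \sum_i w i * t i <= lpnorm t].
Proof.
move=> b0; have rn0 := lt0r_neq0 r0.
have [Nb0|Nb0] := eqVneq (lpnorm b) 0.
  exists (fun=> 0); split=> // [|t _].
    by rewrite Nb0 big1// => i _; rewrite mul0r.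
  by rewrite big1 ?lpnorm_ge0// => i _; rewrite mul0r.
have Nbp : 0 < lpnorm b by rewrite lt_neqAle eq_sym Nb0 lpnorm_ge0.
have unit_sum (t : I -> R) : (forall i, 0 <= t i) -> 0 < lpnorm t ->
    \sum_i (t i / lpnorm t) `^ r = 1.
  move=> t0 Nt; under eq_bigr => i _.
    by rewrite powRM ?invr_ge0 ?lpnorm_ge0//; over.
  by rewrite -mulr_suml -lpnorm_powR -powRM ?invr_ge0 ?lpnorm_ge0// divff ?gt_eqF// powR1.
exists (fun i => (b i / lpnorm b) `^ (r - 1)); split=> [i||t t0].
- exact: powR_ge0.
- transitivity (lpnorm b * \sum_i (b i / lpnorm b) `^ r); last first.
    by rewrite unit_sum// mulr1.
  rewrite mulr_sumr; apply: eq_bigr => i _; rewrite -[in RHS]mulr_powRB1 ?divr_ge0 ?lpnorm_ge0//.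
  by rewrite mulrA [lpnorm b * _]mulrC divfK// mulrC.
have [Nt0|Nt0] := eqVneq (lpnorm t) 0.
  by rewrite Nt0 big1// => i _; rewrite (lpnorm_eq0 i Nt0) mulr0.
have Ntp : 0 < lpnorm t by rewrite lt_neqAle eq_sym Nt0 lpnorm_ge0.
rewrite -[leRHS]mul1r -ler_pdivrMr// mulr_suml.
apply: (@le_trans _ _ (\sum_i ((1 - r^-1) * (b i / lpnorm b) `^ r + r^-1 * (t i / lpnorm t) `^ r))).
  apply: ler_sum => i _; rewrite -mulrA; apply: young_powR.
    exact: divr_ge0 (b0 i) (lpnorm_ge0 b).
  exact: divr_ge0 (t0 i) (lpnorm_ge0 t).
rewrite big_split /= -[X in X + _ <= _]mulr_sumr (unit_sum b b0 Nbp).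
by rewrite -mulr_sumr (unit_sum t t0 Ntp) !mulr1 subrK.
Qed.

End finite_norm.

Section norming.
Variables (R : realType) (k : scalars) (r : R) (r1 : 1 <= r) (I : finType).
Local Notation K := (scalar_field R k).
Local Notation lpn b := (lpnorm r (fun i => rnorm (b i : K^o))).

Lemma rnormM (x y : K) : rnorm (x * y : K^o) = rnorm (x : K^o) * rnorm (y : K^o).
Proof. exact: (@rnormZ R k K^o x y). Qed.

Lemma rnorm_ofreal (x : R) : 0 <= x -> rnorm (ofreal k x : K^o) = x.
Proof.
move=> x0; apply: (can_inj (@ofrealK R k)); rewrite rnormE ger0_norm//.
by rewrite -(ofreal0 R k) ler_ofreal.
Qed.

Lemma ofreal_sum (J : finType) (f : J -> R) :
  ofreal k (\sum_j f j) = \sum_j ofreal k (f j).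
Proof. exact: (big_morph _ (@ofrealD R k) (ofreal0 R k)). Qed.

Lemma ler_rnorm_sum (V : normedZmodType K) (J : Type) (s : seq J) (P : pred J) (f : J -> V) :
  rnorm (\sum_(j <- s | P j) f j) <= \sum_(j <- s | P j) rnorm (f j).
Proof.
elim/big_ind2: _ => [|x a y b xa yb|//]; first by rewrite rnorm0.
by rewrite (le_trans (ler_rnormD _ _))// lerD.
Qed.

(** At 0 the value is 0, so the modulus is 1 only away from 0 and at most 1 everywhere. *)
Definition phase (x : K) : K := `|x| / x.

Lemma phaseM (x : K) : phase x * x = ofreal k (rnorm (x : K^o)).
Proof.
rewrite rnormE /phase; have [->|x0] := eqVneq x 0; last by rewrite divfK.
by rewrite normr0 mulr0.
Qed.

Lemma rnorm_phase (x : K) : rnorm (phase x : K^o) <= 1.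
Proof.
rewrite -(ler_ofreal k) ofreal1 rnormE /phase normrM normfV normr_id.
by have [->|x0] := eqVneq x 0; rewrite ?normr0 ?mul0r ?ler01// divff ?normr_eq0.
Qed.

(** Phases reduce the claim to nonnegative arrays; [lam] is a point of the dual unit ball of [l_r]
    that norms [b]. *)
Lemma norming (b : I -> K) : exists lam : I -> K,
  \sum_i lam i * b i = ofreal k (lpn b) /\
  forall t : I -> K, rnorm (\sum_i lam i * t i : K^o) <= lpn t.
Proof.
have [w [w0 wb wt]] := lpnorm_norming r1 (fun i => rnorm_ge0 (b i : K^o)).
exists (fun i => ofreal k (w i) * phase (b i)); split=> [|t].
  rewrite -wb ofreal_sum; apply: eq_bigr => i _.
  by rewrite -mulrA phaseM -ofrealM.
apply: le_trans (ler_rnorm_sum _ _ _) _.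
apply: le_trans (wt _ (fun i => rnorm_ge0 (t i : K^o))).
apply: ler_sum => i _; rewrite 2!rnormM rnorm_ofreal//.
apply: ler_wpM2r; first exact: rnorm_ge0.
by apply: ler_piMr => //; exact: rnorm_phase.
Qed.

End norming.

(** * Finite nets and finite norming families *)

Lemma segment_net (R : realType) (e : R) : 0 < e ->
  exists s : seq R, forall x, `|x| <= 1 -> exists2 y, y \in s & `|x - y| <= e.
Proof.
move=> e0; exists [seq i%:R * e - 1 | i <- iota 0 (Num.truncn (2 / e)).+1] => x.
rewrite ler_norml => /andP[x1 x2].
have xe : 0 <= (x + 1) / e by apply: divr_ge0; [lra|exact: ltW].
(* The grid starts at -1 with mesh [e]; [x] is rounded down to it. *)
exists ((Num.truncn ((x + 1) / e))%:R * e - 1).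
  apply/mapP; exists (Num.truncn ((x + 1) / e)) => //.
  rewrite mem_iota add0n /= ltnS; apply: le_truncn.
  by rewrite ler_pM2r ?invr_gt0//; lra.
move: (truncn_itv xe); set n := Num.truncn _ => /andP[].
rewrite ler_pdivlMr// ltr_pdivrMr// -natr1 mulrDl mul1r => h1 h2.
by rewrite ler_norml; apply/andP; split; lra.
Qed.

(** In the complex case a product of two real nets of mesh [e / 2] suffices, as
    [u ^ 2 + v ^ 2 <= e ^ 2] when [u] and [v] lie between 0 and [e / 2]. *)
Lemma ball_net (R : realType) (k : scalars) (e : R) : 0 < e ->
  exists s : seq (scalar_field R k), forall x : scalar_field R k,
    rnorm (x : (scalar_field R k)^o) <= 1 ->
    exists2 y, y \in s & rnorm (x - y : (scalar_field R k)^o) <= e.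
Proof.
case: k => e0; first exact: segment_net.
have [s sP] := segment_net (divr_gt0 e0 (ltr0n _ 2)).
exists [seq (a +i* b)%C | a <- s, b <- s] => -[a b].
have nE (c d : R) : @rnorm R ComplexScalars R[i]^o (c +i* d)%C = Num.sqrt (c ^+ 2 + d ^+ 2).
  by [].
have le_re (c d : R) : `|c| <= Num.sqrt (c ^+ 2 + d ^+ 2).
  by rewrite -sqrtr_sqr ler_wsqrtr// lerDl sqr_ge0.
rewrite nE => ab1.
have [a' sa aa'] := sP _ (le_trans (le_re a b) ab1).
have b1 : `|b| <= 1 by apply: le_trans ab1; rewrite addrC le_re.
have [b' sb bb'] := sP _ b1.
exists (a' +i* b')%C; first by apply/allpairsP; exists (a', b').
have -> : ((a +i* b) - (a' +i* b'))%C = ((a - a') +i* (b - b'))%C by [].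
rewrite nE -[leRHS](ger0_norm (ltW e0)) -sqrtr_sqr ler_wsqrtr//.
have := normr_ge0 (a - a'); have := normr_ge0 (b - b').
rewrite -(real_normK (num_real (a - a'))) -(real_normK (num_real (b - b'))).
move: `|a - a'| `|b - b'| aa' bb' => u v; nra.
Qed.

Section norming_family.
Variables (R : realType) (k : scalars) (r : R) (r1 : 1 <= r) (I : finType).
Local Notation K := (scalar_field R k).
Local Notation lpn b := (lpnorm r (fun i => rnorm (b i : K^o))).
Let r0 : 0 < r. Proof. exact: lt_le_trans ltr01 r1. Qed.

Lemma ler_coord_lpnorm (b : I -> R) i : (forall i, 0 <= b i) -> b i <= lpnorm r b.
Proof.
move=> b0; rewrite -[leLHS]powRr1// -(divff (lt0r_neq0 r0)) powRrM.
have S0 (P : pred I) : 0 <= \sum_(i | P i) b i `^ r.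
  by apply: sumr_ge0 => j _; exact: powR_ge0.
apply: ge0_ler_powR; rewrite ?nnegrE ?powR_ge0 ?S0 ?invr_ge0 ?(ltW r0)//.
by rewrite (bigD1 i)//= lerDl S0.
Qed.

(** Testing the norming weights on unit vectors shows that each is at most 1. *)
Lemma lpnorm_le_sum (b : I -> R) : (forall i, 0 <= b i) -> lpnorm r b <= \sum_i b i.
Proof.
move=> b0; have [w [w0 <- wt]] := lpnorm_norming r1 b0.
apply: ler_sum => i _; apply: ler_piMl => //.
have := wt (fun j => (j == i)%:R) (fun j => ler0n _ _).
rewrite (bigD1 i)//= eqxx mulr1 big1 => [|j /negbTE ->]; last by rewrite mulr0.
rewrite addr0 /lpnorm (bigD1 i)//= eqxx big1 => [|j /negbTE ->]; last first.
  by rewrite powR0// gt_eqF.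
by rewrite addr0 !powR1.
Qed.

(** Minkowski's inequality, obtained by evaluating a norming functional of the sum on both
    summands. *)
Lemma ler_lpnD (b c : I -> K) : lpn (fun i => b i + c i) <= lpn b + lpn c.
Proof.
have [lam [lb lt]] := norming r1 (fun i => b i + c i).
rewrite -[leLHS](rnorm_ofreal k) ?lpnorm_ge0// -lb.
under eq_bigr do rewrite mulrDr.
by rewrite big_split (le_trans (ler_rnormD _ _))// lerD.
Qed.

Lemma lpnZ (c : K) (b : I -> K) : lpn (fun i => c * b i) = rnorm (c : K^o) * lpn b.
Proof.
rewrite /lpnorm; under eq_bigr do rewrite rnormM powRM ?rnorm_ge0//.
rewrite -mulr_sumr powRM ?powR_ge0//; last by apply: sumr_ge0 => i _; exact: powR_ge0.
by rewrite -powRrM divff ?gt_eqF// powRr1// rnorm_ge0.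
Qed.

Lemma ler_rnormB (V : normedZmodType K) (x y : V) :
  rnorm (x - y) <= rnorm x + rnorm y.
Proof. by rewrite (le_trans (ler_rnormD _ _))// /rnorm normrN. Qed.

(** One norming functional is taken for each array with entries in a finite net. A normalised [b] is
    close to such an array [c], and replacing [b] by [c] costs [#|I| * e] twice: once in the norm
    and once in the value of the functional of [c]. *)
Lemma norming_family (d : R) : 0 < d ->
  exists (J : finType) (a : J -> I -> K),
    (forall j b, rnorm (\sum_i a j i * b i : K^o) <= lpn b) /\
    forall (b : I -> K) (B : R), 0 <= B ->
      (forall j, rnorm (\sum_i a j i * b i : K^o) <= B) -> (1 - d) * lpn b <= B.
Proof.
(* The mesh makes the total loss [2 * #|I| * e] at most [d]; the extra 1 keeps [N] positive when [I]
   is empty. *)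
move=> d0; pose N := (2 * #|I| + 1)%N; pose e := d / N%:R.
have N0 : 0 < N%:R :> R by rewrite ltr0n /N addn1.
have [s sP] := ball_net k (divr_gt0 d0 N0).
have [a aP] := choice (fun c : {ffun I -> seq_sub s} => norming r1 (fun i => ssval (c i))).
exists {ffun I -> seq_sub s}, a; split=> [j b|b B B0 aB]; first exact: (aP j).2.
have [b0|bn0] := eqVneq (lpn b) 0; first by rewrite b0 mulr0.
have bp : 0 < lpn b by rewrite lt_neqAle eq_sym bn0 lpnorm_ge0.
pose b' i := ofreal k (lpn b)^-1 * b i.
have b'E : lpn b' = 1.
  by rewrite lpnZ rnorm_ofreal ?invr_ge0 ?lpnorm_ge0// mulVf.
have c_ex i : exists c : seq_sub s, rnorm (b' i - ssval c : K^o) <= e.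
  have [|y sy ye] := sP (b' i); last by exists (SeqSub sy).
  by rewrite -b'E; apply: (@ler_coord_lpnorm (fun i => rnorm (b' i : K^o))) => j; exact: rnorm_ge0.
have [c' cP'] := choice c_ex.
pose c := finfun c'; have cP i : rnorm (b' i - ssval (c i) : K^o) <= e by rewrite ffunE.
have bc : lpn (fun i => b' i - ssval (c i)) <= #|I|%:R * e.
  apply: (le_trans (lpnorm_le_sum (fun=> rnorm_ge0 _))).
  by apply: (le_trans (ler_sum _ (fun i _ => cP i))); rewrite sumr_const mulr_natl.
have c1 : 1 <= lpn (fun i => ssval (c i)) + #|I|%:R * e.
  rewrite -[leLHS]b'E -lerBlDl; apply: le_trans bc; rewrite lerBlDl.
  apply: le_trans (ler_lpnD _ _); rewrite le_eqVlt; apply/orP; left; apply/eqP.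
  by congr lpnorm; apply/funext => i; rewrite addrC subrK.
have c2 : lpn (fun i => ssval (c i)) <= rnorm (\sum_i a c i * b' i : K^o) + #|I|%:R * e.
  rewrite -lerBlDl; apply: le_trans (le_trans ((aP c).2 _) bc); rewrite lerBlDl.
  rewrite -[leLHS](rnorm_ofreal k) ?lpnorm_ge0// -(aP c).1.
  apply: le_trans (ler_rnormB _ _); rewrite le_eqVlt; apply/orP; left; apply/eqP.
  congr rnorm; rewrite -sumrB; apply: eq_bigr => i _.
  by rewrite -mulrBr opprB addrC subrK.
have Ne : 2 * (#|I|%:R * e) <= d.
  rewrite /e mulrA -natrM mulrCA ger_pMr// ler_pdivrMr// mul1r ler_nat /N.
  by rewrite leq_addr.
have c3 : \sum_i a c i * b' i = ofreal k (lpn b)^-1 * \sum_i a c i * b i.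
  by rewrite mulr_sumr; apply: eq_bigr => i _; rewrite mulrCA.
rewrite -ler_pdivlMr//; apply: (@le_trans _ _ (rnorm (\sum_i a c i * b' i : K^o))).
  have key (u v w : R) : 1 <= u + w -> u <= v + w -> 2 * w <= d -> 1 - d <= v.
    by clear; lra.
  exact: key c1 c2 Ne.
rewrite c3 rnormM rnorm_ofreal ?invr_ge0 ?lpnorm_ge0// mulrC.
by rewrite ler_wpM2r// invr_ge0 ltW.
Qed.

End norming_family.

(** * Duality of weakly summable tuples *)

Section dual_facts.
Variables (R : realType) (k : scalars) (X : normedModType (scalar_field R k)).
Local Notation K := (scalar_field R k).

Lemma rnormZr (a : R) (x : X) : 0 <= a -> rnorm (ofreal k a *: x) = a * rnorm x.
Proof. by move=> a0; rewrite rnormZ rnorm_ofreal. Qed.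

Lemma ler_rnorm_dual (g : dual X) (x : X) : rnorm (g x) <= rnorm g * rnorm x.
Proof.
have [x0|xn0] := eqVneq (rnorm x) 0.
  by rewrite (rnorm_eq0 x0) linear0 !rnorm0 mulr0.
have xp : 0 < rnorm x by rewrite lt_neqAle eq_sym xn0 rnorm_ge0.
rewrite -ler_pdivrMr// rnorm_dual mulrC.
have /(@dual_norm_ub _ _ _ g) : rnorm (ofreal k (rnorm x)^-1 *: x) <= 1.
  by rewrite rnormZr ?invr_ge0 ?rnorm_ge0// mulVf.
by rewrite linearZ /= rnormZ rnorm_ofreal ?invr_ge0 ?rnorm_ge0.
Qed.

Lemma rnorm_dual_le (g : dual X) (C : R) :
  (forall x, rnorm x <= 1 -> rnorm (g x) <= C) -> rnorm g <= C.
Proof. by rewrite rnorm_dual; exact: dual_norm_le. Qed.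

Lemma dual_ext (f g : dual X) : (forall x, f x = g x) -> f = g.
Proof. by move=> fg; apply: val_inj; apply/funext. Qed.

Lemma dual_sumE (J : Type) (s : seq J) (P : pred J) (g : J -> dual X) (x : X) :
  (\sum_(j <- s | P j) g j) x = \sum_(j <- s | P j) g j x.
Proof. exact: (big_morph (fun g : dual X => g x) (fun f h => dualD f h x) (dual0 x)). Qed.

Lemma bounded_dual (F : {linear X -> K^o}) (C : R) :
  (forall x, rnorm (F x) <= C * rnorm x) -> exists g : dual X, forall x, g x = F x.
Proof.
move=> FC.
have Fc : continuous F.
  apply: bounded_linear_continuous.
  apply/linear_boundedP; exists (ofreal k `|C|); split.
    by rewrite realE -(ofreal0 R k) ler_ofreal normr_ge0.
  move=> M CM x; rewrite -[`|F x|]rnormE; apply: (le_trans (y := ofreal k (`|C| * rnorm x))).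
    by rewrite ler_ofreal (le_trans (FC x))// ler_wpM2r ?rnorm_ge0// ler_norm.
  by rewrite ofrealM rnormE ler_wpM2r// ltW.
have Fd : is_dual F by apply/asboolP; split => //; exact: linearP.
by exists (Dual Fd).
Qed.

Lemma dual_near_norm (g : dual X) (e : R) : 0 < e ->
  exists x, rnorm x <= 1 /\ rnorm g - e <= rnorm (g x).
Proof.
move=> e0; have [_ [x x1 <-] lt] := sup_adherent e0 (dual_norm_set_sup g).
by exists x; split=> //; rewrite rnorm_dual ltW.
Qed.

End dual_facts.

Lemma le_of_forall_scaled (R : realType) (x y : R) : 0 <= x ->
  (forall d, 0 < d -> d < 1 -> (1 - d) * x <= y) -> x <= y.
Proof.
move=> x0 h; apply/ler_addgt0Pr => e e0.
have x1 : 0 < x + e + 1 by lra.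
(* The denominator makes [d] less than 1 and [d * x] at most [e]. *)
have d0 : 0 < e / (x + e + 1) by exact: divr_gt0.
have d1 : e / (x + e + 1) < 1 by rewrite ltr_pdivrMr//; lra.
have := h _ d0 d1.
have dx : e / (x + e + 1) * x <= e.
  by rewrite mulrAC ler_pdivrMr// ler_pM2l//; lra.
by move: dx; set u := e / _ * x; rewrite mulrBl mul1r -/u; lra.
Qed.

(** * Functionals on finite l_oo-sums *)

Section sum_functionals.
Variables (R : realType) (k : scalars) (J : finType).
Local Notation K := (scalar_field R k).
Variables (Y : normedModType K).

Definition maxnorm (v : J -> Y) : R := \big[Num.max/0]_j rnorm (v j).

Lemma maxnorm_ge (v : J -> Y) j : rnorm (v j) <= maxnorm v.
Proof. exact: (le_bigmax_cond 0 (fun j => rnorm (v j))). Qed.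

Lemma maxnorm_le (v : J -> Y) C : 0 <= C -> (forall j, rnorm (v j) <= C) -> maxnorm v <= C.
Proof. by move=> C0 vC; apply/bigmax_leP; split=> // j _; exact: vC. Qed.

Lemma maxnorm_ge0 (v : J -> Y) : 0 <= maxnorm v.
Proof. exact: bigmax_ge_id. Qed.

Lemma seminorm_maxnorm (C : R) : 0 <= C -> seminorm (fun v : J -> Y => C * maxnorm v).
Proof.
move=> C0; split=> [u v|c v].
  rewrite -mulrDr ler_wpM2l//; apply: maxnorm_le => [|j].
    by rewrite addr_ge0 ?maxnorm_ge0.
  by rewrite (le_trans (ler_rnormD _ _))// lerD ?maxnorm_ge.
rewrite mulrCA; congr (_ * _); apply/eqP; rewrite eq_le.
have le (a : K) w : maxnorm (a *: w) <= rnorm (a : K^o) * maxnorm w.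
  apply: maxnorm_le => [|j]; first by rewrite mulr_ge0 ?rnorm_ge0 ?maxnorm_ge0.
  by rewrite -[(_ *: _) j]/(a *: w j) rnormZ ler_wpM2l ?rnorm_ge0 ?maxnorm_ge.
rewrite le /=; have [->|c0] := eqVneq c 0.
  by rewrite rnorm0 mul0r maxnorm_ge0.
have := le c^-1 (c *: v); rewrite scalerA mulVf// scale1r => h.
have cc : rnorm (c : K^o) * rnorm (c^-1 : K^o) = 1.
  by rewrite -rnormM divff// -[1](ofreal1 R k) rnorm_ofreal.
apply: le_trans (ler_wpM2l (rnorm_ge0 _) h) _.
by rewrite mulrA cc mul1r.
Qed.

Definition single (j : J) (y : Y) : J -> Y := fun i => if i == j then y else 0.

Fact single_linear j : linear (single j).
Proof.
move=> a x y; apply/funext => i.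
rewrite -[RHS]/(a *: single j x i + single j y i) /single.
by case: ifP => // _; rewrite scaler0 addr0.
Qed.
HB.instance Definition _ j := GRing.isLinear.Build K Y (J -> Y) *:%R (single j) (single_linear j).

Lemma sum_single (v : J -> Y) : v = \sum_j single j (v j).
Proof.
apply/funext => i; rewrite fct_sumE (bigD1 i)//= /single eqxx big1 ?addr0// => j.
by rewrite eq_sym => /negbTE ->.
Qed.

Lemma maxnorm_single j y : maxnorm (single j y) = rnorm y.
Proof.
apply/eqP; rewrite eq_le maxnorm_le ?rnorm_ge0//=.
  by have := maxnorm_ge (single j y) j; rewrite /single eqxx.
by move=> i; rewrite /single; case: ifP => // _; rewrite rnorm0 rnorm_ge0.
Qed.

(** The dual of a finite [l_oo]-sum is the [l_1]-sum of the duals: nearly norming vectors of the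
    components, rotated by phases, form a single vector of [maxnorm] at most 1 at which all
    contributions add up. *)
Lemma maxnorm_functional (F : {linear (J -> Y) -> K^o}) (C : R) :
  0 <= C -> (forall v, rnorm (F v) <= C * maxnorm v) ->
  exists g : J -> dual Y, (forall v, F v = \sum_j g j (v j)) /\
    \sum_j rnorm (g j) <= C.
Proof.
move=> C0 FC.
have /choice[g gF] j : exists g : dual Y, forall y, g y = F (single j y).
  have [|g gE] := @bounded_dual R k Y (F \o single j) C.
    by move=> y /=; rewrite -[in leRHS](maxnorm_single j) FC.
  by exists g.
have FE v : F v = \sum_j g j (v j).
  by rewrite {1}[v]sum_single linear_sum; apply: eq_bigr => j _; rewrite gF.
exists g; split=> //; apply/ler_addgt0Pr => e e0; pose e' := e / (#|J|%:R + 1).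
have J1 : 0 < #|J|%:R + 1 :> R by rewrite ltr_wpDl.
have /choice[x xP] j := dual_near_norm (g j) (divr_gt0 e0 J1).
pose v j := phase (g j (x j)) *: x j.
have v1 j : rnorm (v j) <= 1.
  by rewrite rnormZ mulr_ile1 ?rnorm_ge0 ?rnorm_phase ?(xP j).1.
have Fv : F v = ofreal k (\sum_j rnorm (g j (x j))).
  by rewrite FE ofreal_sum; apply: eq_bigr => j _; rewrite linearZ; exact: phaseM.
have sC : \sum_j rnorm (g j (x j)) <= C.
  rewrite -[leLHS](rnorm_ofreal k); last by apply: sumr_ge0 => j _; exact: rnorm_ge0.
  rewrite -Fv (le_trans (FC v))// ler_piMr//.
  by apply: maxnorm_le.
rewrite -lerBlDr; apply: le_trans sC.
apply: (@le_trans _ _ (\sum_j (rnorm (g j) - e'))).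
  rewrite sumrB lerD2l lerN2 sumr_const -mulr_natl /e' mulrA ler_pdivrMr// mulrC.
  by rewrite ler_pM2l// lerDl.
by apply: ler_sum => j _; exact: (xP j).2.
Qed.

End sum_functionals.

(* On n-tuples of Y the weak l_r norm has as its bidual norm the weak l_r norm
   on n-tuples of Y**. *)
Lemma weak_tuple_bidual (R : realType) (k : scalars) (r : R) (I : finType)
    (Y : normedModType (scalar_field R k)) (psi : I -> dual Y)
    (f : I -> dual (dual Y)) (M W : R) :
  1 <= r -> 0 <= M ->
  (forall (y : I -> Y) (B : R), 0 <= B ->
    (forall g : dual Y, rnorm g <= 1 -> lpnorm r (fun i => rnorm (g (y i))) <= B) ->
    rnorm (\sum_i psi i (y i)) <= M * B) ->
  (forall g : dual Y, rnorm g <= 1 -> lpnorm r (fun i => rnorm (f i g)) <= W) ->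
  rnorm (\sum_i f i (psi i)) <= M * W.
Proof.
set K := scalar_field R k => r1 M0 psiM fW.
have W0 : 0 <= W.
  by apply: le_trans (lpnorm_ge0 _ _) (fW 0 _); rewrite rnorm0.
apply: le_of_forall_scaled => [|d d0 d1]; first exact: rnorm_ge0.
have d1' : 0 < 1 - d by rewrite subr_gt0.
have [J [a [a_le a_ge]]] := norming_family k r1 I d0.
pose A (y : I -> Y) : J -> Y := fun j => \sum_i a j i *: y i.
have Al : linear A.
  move=> c x y; apply/funext => j; rewrite /A -[RHS]/(c *: (\sum_i _) + \sum_i _).
  rewrite scaler_sumr -big_split; apply: eq_bigr => i _ /=.
  by rewrite -[(c *: x + y) i]/(c *: x i + y i) scalerDr !scalerA mulrC.
pose A' : {linear (I -> Y) -> (J -> Y)} := HB.pack A (GRing.isLinear.Build _ _ _ _ _ Al).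
pose P (y : I -> Y) : K^o := \sum_i psi i (y i).
have Pl : linear P.
  move=> c x y; rewrite /P scaler_sumr -big_split; apply: eq_bigr => i _ /=.
  by rewrite -[(c *: x + y) i]/(c *: x i + y i) linearP.
pose P' : {linear (I -> Y) -> K^o} := HB.pack P (GRing.isLinear.Build _ _ _ _ _ Pl).
have C0 : 0 <= M / (1 - d) by rewrite divr_ge0// ltW.
(* Each functional of norm at most 1 is bounded by [maxnorm (A y)] on the entries of [A y], so the
   weak norm of [y] is at most [B = maxnorm (A y) / (1 - d)]. *)
have PA y : rnorm (P' y) <= M / (1 - d) * maxnorm (A' y).
  rewrite -mulrA; apply: psiM => [|g g1].
    by rewrite mulr_ge0 ?maxnorm_ge0// invr_ge0 ltW.
  rewrite ler_pdivlMl//; apply: a_ge => [|j]; first exact: maxnorm_ge0.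
  have -> : \sum_i a j i * g (y i) = g (A y j).
    by rewrite linear_sum; apply: eq_bigr => i _; rewrite linearZ.
  apply: le_trans (maxnorm_ge (A y) j); apply: le_trans (ler_rnorm_dual _ _) _.
  by rewrite ler_piMl// rnorm_ge0.
have [F [FC FA]] := seminorm_extension (seminorm_maxnorm _ _ C0) PA.
have [g [gF gC]] := maxnorm_functional C0 FC.
(* The extension is read off on tuples supported at the single index [i]. *)
have psiE i : psi i = \sum_j a j i *: g j.
  apply: dual_ext => y; rewrite dual_sumE.
  have -> : psi i y = P (single i y).
    rewrite /P (bigD1 i)//= {1}/single eqxx big1 ?addr0// => i' /negbTE ii'.
    by rewrite /single ii' linear0.
  rewrite -[LHS]FA gF; apply: eq_bigr => j _.
  rewrite -[A' _ j]/(\sum_i' a j i' *: single i y i') (bigD1 i)//= {1}/single eqxx.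
  rewrite big1 ?addr0 ?linearZ// => i' /negbTE ii'.
  by rewrite /single ii' scaler0.
have -> : \sum_i f i (psi i) = \sum_j (\sum_i a j i *: f i) (g j).
  under eq_bigr do rewrite psiE linear_sum.
  rewrite exchange_big; apply: eq_bigr => j _; rewrite dual_sumE.
  by apply: eq_bigr => i _; rewrite linearZ.
have aW j : rnorm (\sum_i a j i *: f i) <= W.
  apply: rnorm_dual_le => h h1; rewrite dual_sumE.
  exact: le_trans (a_le j (fun i => f i h)) (fW h h1).
rewrite mulrC -ler_pdivlMr// mulrAC mulrC; apply: le_trans (ler_wpM2l W0 gC).
rewrite mulr_sumr; apply: le_trans (ler_rnorm_sum _ _ _) _.
apply: ler_sum => j _; apply: le_trans (ler_rnorm_dual _ _) _.
by rewrite ler_wpM2r ?rnorm_ge0.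
Qed.

(** * Weak, mid and dual mid norms *)

(** Replaces a bound that may vanish by a positive one, by which a family can be divided. *)
Lemma le_mul_eps (R : realType) (x M B : R) : 0 <= M ->
  (forall e, 0 < e -> x <= M * (B + e)) -> x <= M * B.
Proof.
move=> M0 h; apply/ler_addgt0Pr => e e0.
have M1 : 0 < M + 1 by lra.
apply: le_trans (h _ (divr_gt0 e0 M1)) _.
by rewrite mulrDr lerD2l mulrCA ger_pMr// ler_pdivrMr//; lra.
Qed.

Lemma sum_trunc_le (R : numDomainType) (F : nat -> R) (m N : nat) :
  (forall j, 0 <= F j) -> (forall j, (m <= j)%N -> F j = 0) ->
  \sum_(0 <= j < N) F j <= \sum_(0 <= j < m) F j.
Proof.
move=> F0 Fm; have [Nm|mN] := leqP N m.
  by rewrite (big_cat_nat _ Nm)//= lerDl sumr_ge0.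
rewrite (big_cat_nat _ (ltnW mN))//= [X in _ + X]big1_seq ?addr0// => j.
by rewrite mem_index_iota => /andP[_ /andP[mj _]]; exact: Fm.
Qed.

Lemma nneseries_leP (R : realType) (u : nat -> R) (B : R) : (forall j, 0 <= u j) ->
  (\sum_(0 <= j <oo) (u j)%:E <= B%:E)%E <-> forall n, \sum_(0 <= j < n) u j <= B.
Proof.
move=> u0; split=> [uB n|uB].
  rewrite -lee_fin -sumEFin; apply: le_trans uB; apply: nneseries_lim_ge => j _ _.
  by rewrite lee_fin.
apply: lime_le; first by apply: is_cvg_nneseries => j _ _; rewrite lee_fin.
by apply: nearW => n; rewrite sumEFin lee_fin.
Qed.

(** Finitely many rows add up to one series, whose partial sums are the sums over rectangles. *)
Lemma nneseries2_leP (R : realType) (u : nat -> nat -> R) (B : R) : (forall i j, 0 <= u i j) ->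
  (\sum_(0 <= i <oo) \sum_(0 <= j <oo) (u i j)%:E <= B%:E)%E <->
  forall n m, \sum_(0 <= i < n) \sum_(0 <= j < m) u i j <= B.
Proof.
move=> u0; have s0 i : (0 <= \sum_(0 <= j <oo) (u i j)%:E)%E.
  by apply: nneseries_ge0 => j _ _; rewrite lee_fin.
split=> [uB n m|uB].
  rewrite -lee_fin -sumEFin; apply: le_trans uB.
  apply: le_trans (nneseries_lim_ge (P := xpredT) n _); last by move=> i _ _; exact: s0.
  apply: lee_sum => i _; rewrite -sumEFin; apply: nneseries_lim_ge => j _ _.
  by rewrite lee_fin.
apply: lime_le; first by apply: is_cvg_nneseries => i _ _; exact: s0.
apply: nearW => n; rewrite -nneseries_sum_nat; last by move=> *; rewrite lee_fin.
under eq_eseriesr do rewrite sumEFin.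
apply/nneseries_leP => [j|m]; first by apply: sumr_ge0.
by rewrite exchange_big.
Qed.

Lemma poweR_root_le (R : realType) (a : \bar R) (r B : R) :
  0 < r -> (0 <= a)%E -> 0 <= B -> (a `^ r^-1 <= B%:E)%E = (a <= (B `^ r)%:E)%E.
Proof.
move=> r0 a0 B0; have rn0 := lt0r_neq0 r0.
case: a a0 => [a| |] //; last by rewrite poweRyr ?invr_eq0// !leye_eq.
rewrite poweR_EFin !lee_fin => a0; apply/idP/idP => h.
  have : (a `^ r^-1) `^ r <= B `^ r.
    by apply: ge0_ler_powR; rewrite ?nnegrE ?powR_ge0 ?(ltW r0).
  by rewrite -powRrM mulVf// powRr1.
have : a `^ r^-1 <= (B `^ r) `^ r^-1.
  by apply: ge0_ler_powR; rewrite ?nnegrE ?powR_ge0 ?invr_ge0 ?(ltW r0).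
by rewrite -[leRHS]powRrM divff// powRr1.
Qed.

Section norm_bounds.
Variables (R : realType) (k : scalars) (Z : normedModType (scalar_field R k)).
Local Notation K := (scalar_field R k).

Lemma weak_norm_leP (r B : R) (z : nat -> Z) : 0 < r -> 0 <= B ->
  (weak_norm r%:E z <= B%:E)%E <->
  forall g : dual Z, rnorm g <= 1 ->
    forall n, \sum_(0 <= j < n) rnorm (g (z j)) `^ r <= B `^ r.
Proof.
move=> r0 B0; have s0 (g : dual Z) : (0 <= \sum_(0 <= j <oo) (rnorm (g (z j)) `^ r)%:E)%E.
  by apply: nneseries_ge0 => j _ _; rewrite lee_fin powR_ge0.
split=> [zB g g1 n|zB].
  have /nneseries_leP : (\sum_(0 <= j <oo) (rnorm (g (z j)) `^ r)%:E <= (B `^ r)%:E)%E.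
    by rewrite -poweR_root_le//; apply: le_trans zB; apply: ereal_sup_ubound; exists g.
  by apply => j; exact: powR_ge0.
apply: ge_ereal_sup => _ [g g1 <-]; rewrite poweR_root_le//.
by apply/nneseries_leP => [j|n]; [exact: powR_ge0|exact: zB].
Qed.

Lemma mid_sum_leP (r B : R) (f : nat -> dual Z) (z : nat -> Z) :
  (mid_sum r f z <= B%:E)%E <->
  forall n m, \sum_(0 <= i < n) \sum_(0 <= j < m) rnorm (f i (z j)) `^ r <= B.
Proof. by apply: nneseries2_leP => i j; exact: powR_ge0. Qed.

Lemma mid_norm_leP (r B : R) (z : nat -> Z) : 0 < r -> 0 <= B ->
  (mid_norm r%:E z <= B%:E)%E <->
  forall f : nat -> dual Z, (weak_norm r%:E f <= 1)%E ->
    forall n m, \sum_(0 <= i < n) \sum_(0 <= j < m) rnorm (f i (z j)) `^ r <= B `^ r.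
Proof.
move=> r0 B0; have s0 (f : nat -> dual Z) : (0 <= mid_sum r f z)%E.
  apply: nneseries_ge0 => i _ _; apply: nneseries_ge0 => j _ _.
  by rewrite lee_fin powR_ge0.
split=> [zB f f1|zB].
  apply/mid_sum_leP; rewrite -poweR_root_le//.
  by apply: le_trans zB; apply: ereal_sup_ubound; exists f.
apply: ge_ereal_sup => _ [f f1 <-]; rewrite poweR_root_le//.
by apply/mid_sum_leP; exact: zB.
Qed.

Lemma sup_norm_leP (B : R) (z : nat -> Z) :
  (sup_norm z <= B%:E)%E <-> forall j, rnorm (z j) <= B.
Proof.
split=> [zB j|zB].
  by rewrite -lee_fin; apply: le_trans zB; apply: ereal_sup_ubound; exists j.
by apply: ge_ereal_sup => _ [j _ <-]; rewrite lee_fin.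
Qed.

Lemma weak_norm_ge0 (p : \bar R) (z : nat -> Z) : (0 <= weak_norm p z)%E.
Proof.
have S0 : (0 <= sup_norm z)%E.
  apply: (@le_trans _ _ (rnorm (z 0%N))%:E); first by rewrite lee_fin rnorm_ge0.
  by apply: ereal_sup_ubound; exists 0%N.
case: p => [r| |] //=.
apply: (@le_trans _ _ ((\sum_(0 <= j <oo) (rnorm ((0 : dual Z) (z j)) `^ r)%:E) `^ r^-1)%E).
  exact: poweR_ge0.
by apply: ereal_sup_ubound; exists 0 => //=; rewrite rnorm0 ler01.
Qed.

Lemma weak_norm_scale (p : \bar R) (a w : R) (z : nat -> Z) : (1 <= p)%E ->
  0 <= a -> 0 <= w -> (weak_norm p z <= w%:E)%E ->
  (weak_norm p (fun j => ofreal k a *: z j) <= (a * w)%:E)%E.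
Proof.
case: p => [r| |]//; rewrite ?lee_fin => r1 a0 w0.
  have r0 : 0 < r := lt_le_trans ltr01 r1.
  move=> /weak_norm_leP h; apply/weak_norm_leP => //; first exact: mulr_ge0.
  move=> g g1 n; rewrite powRM//; apply: le_trans (ler_wpM2l (powR_ge0 _ _) (h r0 w0 g g1 n)).
  rewrite mulr_sumr; apply: ler_sum => j _.
  by rewrite linearZ rnormZr// powRM ?rnorm_ge0.
move=> /sup_norm_leP h; apply/sup_norm_leP => j.
by rewrite rnormZr// ler_wpM2l.
Qed.

Lemma mid_norm_scale (p : \bar R) (a w : R) (z : nat -> Z) : (1 <= p)%E ->
  0 <= a -> 0 <= w -> (mid_norm p z <= w%:E)%E ->
  (mid_norm p (fun j => ofreal k a *: z j) <= (a * w)%:E)%E.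
Proof.
case: p => [r| |]//; rewrite ?lee_fin => r1 a0 w0.
  have r0 : 0 < r := lt_le_trans ltr01 r1.
  move=> /mid_norm_leP h; apply/mid_norm_leP => //; first exact: mulr_ge0.
  move=> f f1 n m; rewrite powRM//; apply: le_trans (ler_wpM2l (powR_ge0 _ _) (h r0 w0 f f1 n m)).
  rewrite mulr_sumr; apply: ler_sum => i _; rewrite mulr_sumr; apply: ler_sum => j _.
  by rewrite linearZ rnormZr// powRM ?rnorm_ge0.
move=> /sup_norm_leP h; apply/sup_norm_leP => j.
by rewrite rnormZr// ler_wpM2l.
Qed.

Lemma in_lpmid_scale (p : \bar R) (a : R) (z : nat -> Z) : (1 <= p)%E ->
  0 <= a -> in_lpmid p z -> in_lpmid p (fun j => ofreal k a *: z j).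
Proof.
move=> p1; case: p p1 => [r| |] p1 a0 /=; last by [].
  rewrite lee_fin in p1; have r0 : 0 < r := lt_le_trans ltr01 p1.
  move=> h f /h fz; have fz0 : (0 <= mid_sum r f z)%E.
    apply: nneseries_ge0 => i _ _; apply: nneseries_ge0 => j _ _.
    by rewrite lee_fin powR_ge0.
  have : (mid_sum r f z <= (fine (mid_sum r f z))%:E)%E by rewrite fineK// ge0_fin_numE.
  move=> /mid_sum_leP h'; apply: le_lt_trans (ltry (a `^ r * fine (mid_sum r f z))).
  apply/mid_sum_leP => n m; apply: le_trans (ler_wpM2l (powR_ge0 _ _) (h' n m)).
  rewrite mulr_sumr; apply: ler_sum => i _; rewrite mulr_sumr; apply: ler_sum => j _.
  by rewrite linearZ rnormZr// powRM ?rnorm_ge0.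
move=> zoo; have /sup_norm_leP h : (sup_norm z <= (fine (sup_norm z))%:E)%E.
  by rewrite fineK// ge0_fin_numE//; exact: (weak_norm_ge0 +oo%E z).
apply: le_lt_trans (ltry (a * fine (sup_norm z))).
by apply/sup_norm_leP => j; rewrite rnormZr// ler_wpM2l.
Qed.

Lemma finite_weak_norm (p : \bar R) (s : seq Z) : (1 <= p)%E ->
  exists2 w : R, 0 <= w & (weak_norm p (fun j => nth 0%R s j) <= w%:E)%E.
Proof.
case: p => [r| |]//; rewrite ?lee_fin => r1.
  have r0 : 0 < r := lt_le_trans ltr01 r1.
  pose S := \sum_(0 <= j < size s) rnorm (nth 0 s j) `^ r.
  have S0 : 0 <= S by apply: sumr_ge0 => j _; exact: powR_ge0.
  exists (S `^ r^-1); first exact: powR_ge0.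
  apply/weak_norm_leP => [//||g g1 n]; first exact: powR_ge0.
  rewrite -powRrM mulVf ?gt_eqF// powRr1//.
  apply: (@le_trans _ _ (\sum_(0 <= j < n) rnorm (nth 0 s j) `^ r)).
    apply: ler_sum => j _; apply: ge0_ler_powR; rewrite ?nnegrE ?rnorm_ge0 ?(ltW r0)//.
    by apply: le_trans (ler_rnorm_dual _ _) _; rewrite ler_piMl// rnorm_ge0.
  apply: sum_trunc_le => j; first exact: powR_ge0.
  by move=> sj; rewrite nth_default// rnorm0 powR0// gt_eqF.
exists (\sum_(0 <= j < size s) rnorm (nth 0 s j)).
  by apply: sumr_ge0 => j _; exact: rnorm_ge0.
apply/sup_norm_leP => j; have [sj|js] := leqP (size s) j.
  by rewrite nth_default// rnorm0; apply: sumr_ge0 => i _; exact: rnorm_ge0.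
rewrite (bigD1_seq j) ?mem_index_iota ?iota_uniq//= lerDl.
by apply: sumr_ge0 => i _; exact: rnorm_ge0.
Qed.

End norm_bounds.

Section bidual_embedding.
Variables (R : realType) (k : scalars) (Y : normedModType (scalar_field R k)).
Local Notation K := (scalar_field R k).

Lemma bidual_embedding : exists ev : {linear Y -> dual (dual Y)},
  forall y (g : dual Y), ev y g = g y.
Proof.
have /choice[ev evE] y : exists e : dual (dual Y), forall g : dual Y, e g = g y.
  have el : linear ((fun g : dual Y => g y) : dual Y -> K^o) by [].
  pose e : {linear dual Y -> K^o} :=
    HB.pack (_ : dual Y -> K^o) (GRing.isLinear.Build _ _ _ _ _ el).
  have [|e' e'E] := @bounded_dual R k (dual Y) e (rnorm y); last by exists e'.
  by move=> g; rewrite mulrC; exact: ler_rnorm_dual.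
have evl : linear ev.
  by move=> c x y; apply: dual_ext => g; rewrite dualD dualZ !evE linearP.
pose evL : {linear Y -> dual (dual Y)} := HB.pack ev (GRing.isLinear.Build _ _ _ _ _ evl).
by exists evL.
Qed.

Lemma rnorm_bidual_le (ev : {linear Y -> dual (dual Y)}) :
  (forall y (g : dual Y), ev y g = g y) -> forall y, rnorm (ev y) <= rnorm y.
Proof.
move=> evE y; apply: rnorm_dual_le => g g1; rewrite evE.
by apply: le_trans (ler_rnorm_dual _ _) _; rewrite ler_piMl// rnorm_ge0.
Qed.

(** A functional in the unit ball of the third dual composes with [ev] to one in the unit ball of
    [dual Y]. *)
Lemma weak_norm_bidual (ev : {linear Y -> dual (dual Y)}) (r w : R) (y : nat -> Y) :
  (forall y (g : dual Y), ev y g = g y) -> 0 < r -> 0 <= w ->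
  (weak_norm r%:E y <= w%:E)%E -> (weak_norm r%:E (ev \o y) <= w%:E)%E.
Proof.
move=> evE r0 w0 /weak_norm_leP h; apply/weak_norm_leP => // G G1 n.
have Gev z : rnorm (G (ev z)) <= 1 * rnorm z.
  rewrite mul1r; apply: le_trans (ler_rnorm_dual _ _) _.
  by apply: le_trans (rnorm_bidual_le evE z); rewrite ler_piMl// rnorm_ge0.
have [g gE] := @bounded_dual R k Y (G \o ev) 1 Gev.
have g1 : rnorm g <= 1.
  by apply: rnorm_dual_le => z z1; rewrite gE (le_trans (Gev z))// mul1r.
by have := h r0 w0 g g1 n; under eq_bigr do rewrite gE.
Qed.

(** The evaluation at a vector of the unit ball, followed by zeros, is an admissible test sequence;
    a single term of the resulting double sum already gives the bound. *)
Lemma mid_norm_coord (p : \bar R) (B : R) (z : nat -> dual Y) : (1 <= p)%E -> 0 <= B ->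
  (mid_norm p z <= B%:E)%E -> forall j, rnorm (z j) <= B.
Proof.
case: p => [r| |]//; rewrite ?lee_fin => r1 B0; last by move=> /sup_norm_leP.
have r0 : 0 < r := lt_le_trans ltr01 r1.
move=> /mid_norm_leP h j; apply: rnorm_dual_le => y y1.
have [ev evE] := bidual_embedding.
pose ys i := if i == 0%N then y else 0.
have ys1 : (weak_norm r%:E ys <= 1)%E.
  apply/weak_norm_leP => // g g1 [|n]; first by rewrite big_geq// powR_ge0.
  rewrite big_nat_recl// big1 => [|i _]; last by rewrite linear0 rnorm0 powR0// gt_eqF.
  rewrite addr0; apply: ge0_ler_powR; rewrite ?nnegrE ?rnorm_ge0 ?(ltW r0)//.
  by apply: le_trans (ler_rnorm_dual _ _) _; rewrite mulr_ile1 ?rnorm_ge0.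
have := h r0 B0 (ev \o ys) (weak_norm_bidual evE r0 ler01 ys1) 1%N j.+1.
rewrite big_nat1 big_nat_recr//= evE => h1.
have : rnorm (z j y) `^ r <= B `^ r.
  by apply: le_trans h1; rewrite lerDr sumr_ge0// => i _; exact: powR_ge0.
move=> h2; rewrite leNgt; apply/negP => h3; move: h2; rewrite leNgt => /negP; apply.
by apply: gt0_ltr_powR; rewrite ?nnegrE ?rnorm_ge0.
Qed.

End bidual_embedding.

Section finite_middual.
Variables (R : realType) (k : scalars) (Y : normedModType (scalar_field R k)).
Local Notation K := (scalar_field R k).

Definition ord_ext (V : nmodType) (m : nat) (y : 'I_m -> V) (j : nat) : V := oapp y 0 (insub j).

Lemma ord_extE (V : nmodType) m (y : 'I_m -> V) (j : 'I_m) : ord_ext y j = y j.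
Proof. by rewrite /ord_ext valK. Qed.

Lemma ord_ext_ge (V : nmodType) m (y : 'I_m -> V) j : (m <= j)%N -> ord_ext y j = 0.
Proof. by move=> mj; rewrite /ord_ext insubF// ltnNge mj. Qed.

Lemma nth_ord_ext (V : nmodType) m (y : 'I_m -> V) j :
  nth 0 [seq y i | i <- enum 'I_m] j = ord_ext y j.
Proof.
have [mj|jm] := leqP m j; first by rewrite ord_ext_ge// nth_default// size_map size_enum_ord.
by rewrite (nth_map (Ordinal jm)) ?size_enum_ord// -(ord_extE y) nth_enum_ord.
Qed.

(* A test sequence [f] of mid norm at most 1 is measured against the evaluations
   at the [y i], a weakly r-summable family of the bidual. *)
Lemma middual_norm_comb (r B : R) (n m : nat) (lam : 'I_n * 'I_m -> K) (y : 'I_n -> Y) :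
  1 <= r -> 0 <= B ->
  (forall t : 'I_n * 'I_m -> K,
    rnorm (\sum_q lam q * t q : K^o) <= lpnorm r (fun q => rnorm (t q : K^o))) ->
  (forall g : dual Y, rnorm g <= 1 -> lpnorm r (fun i => rnorm (g (y i))) <= B) ->
  (middual_norm r%:E (ord_ext (fun j => (\sum_i lam (i, j) *: y i)%R)) <= B%:E)%E.
Proof.
move=> r1 B0 lam1 yB; have r0 : 0 < r := lt_le_trans ltr01 r1.
set eta := fun j => _.
apply: ge_ereal_sup => _ [f [_ f1] <-]; apply/nneseries_leP => [j|N]; first exact: rnorm_ge0.
apply: le_trans (sum_trunc_le _ (m := m) _ _) _ => [j|j mj|]; first exact: rnorm_ge0.
  by rewrite ord_ext_ge// linear0 rnorm0.
have fy : lpnorm r (fun q : 'I_n * 'I_m => rnorm (f q.2 (y q.1))) <= B.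
  rewrite -[B]mul1r; apply: le_mul_eps => // e e0.
  (* Division by [B + e] normalises the family even when [B = 0]. *)
  have Be : 0 < B + e by rewrite ltr_wpDl.
  rewrite mul1r lpnorm_le ?(ltW Be)//.
  have one : 1 `^ r = 1 :> R by rewrite powR1.
  pose ys := ord_ext (fun i => ofreal k (B + e)^-1 *: y i).
  have ys1 : (weak_norm r%:E ys <= 1)%E.
    apply/weak_norm_leP => // g g1 N'.
    apply: le_trans (sum_trunc_le _ (m := n) _ _) _ => [i|i ni|]; first exact: powR_ge0.
      by rewrite /ys ord_ext_ge// linear0 rnorm0 powR0// gt_eqF.
    rewrite big_mkord powR1.
    under eq_bigr do rewrite /ys ord_extE linearZ rnormZr ?invr_ge0 ?(ltW Be)//
      powRM ?rnorm_ge0 ?invr_ge0 ?(ltW Be)//.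
    rewrite -mulr_sumr -lpnorm_powR// -powRM ?lpnorm_ge0 ?invr_ge0 ?(ltW Be)//.
    rewrite -[leRHS]one; apply: ge0_ler_powR; rewrite ?nnegrE ?(ltW r0)//.
      by rewrite mulr_ge0 ?lpnorm_ge0 ?invr_ge0 ?(ltW Be).
    by rewrite ler_pdivrMl// mulr1 (le_trans (yB g g1))// lerDl ltW.
  have [ev evE] := bidual_embedding Y.
  have := (mid_norm_leP f r0 ler01).1 f1 _ (weak_norm_bidual evE r0 ler01 ys1) n m.
  rewrite powR1 big_mkord; under eq_bigr do rewrite big_mkord; move=> h.
  rewrite -[leRHS]mulr1; apply: le_trans (ler_wpM2l (powR_ge0 _ _) h).
  rewrite pair_bigA mulr_sumr; apply: ler_sum => q _ /=.
  rewrite evE /ys ord_extE linearZ rnormZr ?invr_ge0 ?(ltW Be)//.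
  rewrite -powRM ?mulr_ge0 ?rnorm_ge0 ?invr_ge0 ?(ltW Be)//.
  by rewrite mulrA mulfV ?mul1r// gt_eqF.
rewrite big_mkord.
(* Phases make the terms nonnegative reals; expanding [eta] then shows [lam] paired with an array
   dominated entrywise by the values of [f] at the [y i]. *)
have -> : \sum_(j < m) rnorm (f j (ord_ext eta j)) =
    rnorm (\sum_q lam q * (phase (f q.2 (eta q.2)) * f q.2 (y q.1)) : K^o).
  rewrite -[LHS](rnorm_ofreal k); last by apply: sumr_ge0 => j _; exact: rnorm_ge0.
  congr rnorm; rewrite ofreal_sum.
  transitivity (\sum_i \sum_j lam (i, j) * (phase (f j (eta j)) * f j (y i)));
    last by rewrite pair_bigA; apply: eq_bigr => -[].
  rewrite exchange_big; apply: eq_bigr => j _ /=.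
  rewrite ord_extE -phaseM {2}/eta linear_sum mulr_sumr; apply: eq_bigr => i _.
  by rewrite linearZ mulrCA.
apply: le_trans (lam1 _) (le_trans _ fy); apply: ler_lpnorm => // q.
rewrite rnorm_ge0 rnormM/= -[leRHS]mul1r; apply: ler_wpM2r; first exact: rnorm_ge0.
exact: rnorm_phase.
Qed.

End finite_middual.

(** * The functional associated with an operator *)

Section representation.
Variables (R : realType) (k : scalars) (X Y : normedModType (scalar_field R k)).
Variables (p : \bar R) (T : {linear X -> dual Y}).
Hypothesis p1 : (1 <= p)%E.
Local Notation K := (scalar_field R k).
Local Notation Phi := (functional_of T).

Lemma functional_of_sum (J : Type) (s : seq J) (x : J -> X) (y : J -> Y) :
  Phi (\sum_(j <- s) elementary (x j) (y j)) = \sum_(j <- s) T (x j) (y j).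
Proof. by rewrite linear_sum; apply: eq_bigr => j _; rewrite functional_ofE. Qed.

(** Quantifying over real bounds [w] of the weak norm avoids products of extended reals. *)
Definition mid_bound (C : R) := forall (x : nat -> X) (w : R), 0 <= w ->
  (weak_norm p x <= w%:E)%E ->
  in_lpmid p (T \o x) /\ (mid_norm p (T \o x) <= (C * w)%:E)%E.

Lemma alpha_bound_rep (C w B : R) (s : seq (X * Y)) : alpha_bound p Phi C ->
  0 <= w -> 0 <= B ->
  (weak_norm p (fun j => nth 0%R (map fst s) j) <= w%:E)%E ->
  (middual_norm p (fun j => nth 0%R (map snd s) j) <= B%:E)%E ->
  rnorm (\sum_(q <- s) T q.1 q.2) <= C * w * B.
Proof.
move=> [C0 CP] w0 B0 sw sB; rewrite -lee_fin -functional_of_sum.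
apply: le_trans (CP _) _; rewrite -mulrA EFinM; apply: lee_wpmul2l; first by rewrite lee_fin.
rewrite EFinM; apply: (@le_trans _ _ (weak_norm p (fun j => nth 0%R (map fst s) j) *
    middual_norm p (fun j => nth 0%R (map snd s) j))%E).
  by apply: ereal_inf_lbound; exists s.
apply: le_trans (lee_wpmul2l (weak_norm_ge0 _ _) sB) _.
by apply: lee_wpmul2r => //; rewrite lee_fin.
Qed.

Lemma mid_bound_finite_exponent (r C : R) : p = r%:E -> alpha_bound p Phi C -> mid_bound C.
Proof.
move=> pr PC x w w0; have [C0 _] := PC; have r1 : 1 <= r by move: p1; rewrite pr lee_fin.
have r0 : 0 < r := lt_le_trans ltr01 r1.
rewrite pr => xw.
(* The bound [W] serves twice: as an arbitrary finite weak norm for membership in the mid space, and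
   as 1 for the mid norm. *)
have main (f : nat -> dual (dual Y)) (W : R) : 0 <= W -> (weak_norm r%:E f <= W%:E)%E ->
    forall n m, \sum_(0 <= i < n) \sum_(0 <= j < m) rnorm (f i (T (x j))) `^ r
      <= (C * w * W) `^ r.
  move=> W0 /weak_norm_leP fW n m.
  rewrite big_mkord; under eq_bigr do rewrite big_mkord; rewrite pair_bigA /=.
  rewrite -lpnorm_le ?mulr_ge0//.
  have [lam [lamE lam1]] := norming r1 (fun q : 'I_n * 'I_m => f q.1 (T (x q.2)) : K).
  rewrite -[leLHS](rnorm_ofreal k) ?lpnorm_ge0// -lamE.
  pose psi (i : 'I_n) := \sum_(j < m) lam (i, j) *: T (x j).
  have -> : \sum_q lam q * f q.1 (T (x q.2)) = \sum_(i < n) f i (psi i).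
    transitivity (\sum_(i < n) \sum_(j < m) lam (i, j) * f i (T (x j))).
      by rewrite pair_bigA; apply: eq_bigr => -[].
    by apply: eq_bigr => i _; rewrite linear_sum; apply: eq_bigr => j _; rewrite linearZ.
  apply: (@weak_tuple_bidual R k r _ _ psi (fun i : 'I_n => f i)) => //; first exact: mulr_ge0.
    move=> y B B0 yB.
    pose eta (j : 'I_m) := \sum_i lam (i, j) *: y i.
    (* The double sum is read by columns, so that the coefficients pass from the [T (x j)] to the
       [y i]. *)
    have -> : \sum_i psi i (y i) =
        \sum_(q <- [seq (x j, eta j) | j : 'I_m <- enum 'I_m]) T q.1 q.2.
      rewrite big_map big_enum /=.
      under eq_bigr do rewrite dual_sumE.
      rewrite exchange_big; apply: eq_bigr => j _.
      by rewrite linear_sum; apply: eq_bigr => i _; rewrite dualZ linearZ.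
    apply: alpha_bound_rep => //; rewrite pr.
      apply/weak_norm_leP => // g g1 N; rewrite -map_comp.
      apply: le_trans ((weak_norm_leP _ r0 w0).1 xw g g1 N).
      apply: ler_sum => j _; rewrite nth_ord_ext.
      apply: ge0_ler_powR; rewrite ?nnegrE ?rnorm_ge0 ?(ltW r0)//.
      have [mj|jm] := leqP m j; first by rewrite ord_ext_ge// linear0 rnorm0 rnorm_ge0.
      by rewrite (ord_extE _ (Ordinal jm)).
    rewrite -map_comp (_ : (fun j => _) = ord_ext eta).
      exact: middual_norm_comb.
    by apply/funext => j; rewrite nth_ord_ext.
  move=> g g1; rewrite lpnorm_le//.
  (* The weak norm of [f] tests against the third dual, which [g] enters by evaluation. *)
  have [ev evE] := bidual_embedding (dual Y).
  have := fW r0 W0 (ev g) (le_trans (rnorm_bidual_le evE g) g1) n.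
  by rewrite big_mkord; under eq_bigr do rewrite evE.
split=> [f foo|].
  have /main h : (weak_norm r%:E f <= (fine (weak_norm r%:E f))%:E)%E.
    by rewrite fineK// ge0_fin_numE ?weak_norm_ge0.
  apply: le_lt_trans (ltry ((C * w * fine (weak_norm r%:E f)) `^ r)).
  apply/mid_sum_leP; apply: h.
  by rewrite fine_ge0// weak_norm_ge0.
apply/mid_norm_leP => //; first exact: mulr_ge0.
by move=> f f1 n m; rewrite -[C * w]mulr1; exact: main.
Qed.

(** A single elementary tensor of [x j] and [y] suffices, since for [y] in the unit ball the
    one-term sequence has dual mid norm at most 1. *)
Lemma mid_bound_infinite_exponent (C : R) : p = +oo%E -> alpha_bound p Phi C -> mid_bound C.
Proof.
move=> poo PC x w w0; have [C0 _] := PC; rewrite poo => /sup_norm_leP xw.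
have TC : (sup_norm (T \o x) <= (C * w)%:E)%E.
  apply/sup_norm_leP => j; apply: rnorm_dual_le => y y1 /=.
  rewrite -[T (x j) y](big_seq1 (+%R) (x j, y) (fun q => T q.1 q.2)) -[leRHS]mulr1.
  apply: alpha_bound_rep => //; rewrite poo.
    by apply/sup_norm_leP => -[|i] /=; rewrite ?nth_nil ?rnorm0.
  apply: ge_ereal_sup => _ [h [_ /sup_norm_leP h1] <-].
  apply/nneseries_leP => [i|N]; first exact: rnorm_ge0.
  apply: le_trans (sum_trunc_le _ (m := 1%N) _ _) _ => [i|[//|i] _|]; first exact: rnorm_ge0.
    by rewrite /= nth_nil linear0 rnorm0.
  by rewrite big_nat1/= (le_trans (ler_rnorm_dual _ _))// mulr_ile1 ?rnorm_ge0.
by split=> //; apply: le_lt_trans TC (ltry _).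
Qed.

Lemma alpha_bound_mid_bound (C : R) : alpha_bound p Phi C -> mid_bound C.
Proof.
move=> PC; have [[r pr]|poo] : (exists r, p = r%:E) \/ p = +oo%E.
- by case: (p) p1 => [r| |]// _; [left; exists r|right].
- exact: mid_bound_finite_exponent pr PC.
- exact: mid_bound_infinite_exponent poo PC.
Qed.

Lemma weak_norm_real (x : nat -> X) : in_lpw p x ->
  exists2 w : R, 0 <= w & weak_norm p x = w%:E.
Proof.
move=> xoo; exists (fine (weak_norm p x)); first by rewrite fine_ge0// weak_norm_ge0.
by rewrite fineK// ge0_fin_numE ?weak_norm_ge0.
Qed.

Lemma mid_bound_weakly_mid_summing (C : R) : 0 <= C -> mid_bound C ->
  weakly_mid_summing p T /\ (wmid_norm p T <= C%:E)%E.
Proof.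
move=> C0 TC; split; [split=> [x|x _ e e0]|].
- by move=> /weak_norm_real[w w0 xw]; apply: (TC x w w0 _).1; rewrite xw.
(* By linearity one modulus serves at every sequence; [C + 1] replaces [C], which may be 0. *)
- have C1 : 0 < C + 1 by lra.
  exists (e / (C + 1)); first exact: divr_gt0.
  move=> x' _ xx'.
  have [w w0 wE] := weak_norm_real (lt_trans xx' (ltry _)).
  move: xx'; rewrite wE lte_fin ltr_pdivlMr// => we.
  rewrite (_ : (fun j => _) = T \o (fun j => x' j - x j)); last first.
    by apply/funext => j /=; rewrite linearB.
  apply: le_lt_trans (TC _ w w0 _).2 _; first by rewrite wE.
  by rewrite lte_fin; nra.
- apply: ge_ereal_sup => _ [x x1 <-]; rewrite -[C]mulr1.
  exact: (TC x 1 ler01 x1).2.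
Qed.

Lemma mid_norm_ge0 (Z : normedModType K) (z : nat -> Z) : (0 <= mid_norm p z)%E.
Proof.
case: (p) p1 => [r| |]//=; last by move=> _; exact: (weak_norm_ge0 +oo%E z).
rewrite lee_fin => r1; have r0 := lt_le_trans ltr01 r1.
apply: (@le_trans _ _ (mid_sum r (fun=> 0%R : dual Z) z `^ r^-1)%E); first exact: poweR_ge0.
apply: ereal_sup_ubound; exists (fun=> 0) => //=.
apply/(weak_norm_leP _ r0 ler01) => g g1 n; rewrite big1 ?powR_ge0// => j _.
by rewrite linear0 rnorm0 powR0// gt_eqF.
Qed.

(** Continuity at the zero sequence bounds the mid norm on a small ball, and homogeneity carries
    this to the unit ball. *)
Lemma wmid_norm_fin (hT : weakly_mid_summing p T) :
  exists2 C : R, 0 <= C & wmid_norm p T = C%:E.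
Proof.
have xz0 : (weak_norm p (fun=> 0%R : X) <= 0)%E.
  have [w w0 h] := finite_weak_norm ([::] : seq X) p1.
  have := weak_norm_scale p1 (lexx 0) w0 h; rewrite mul0r.
  by congr (weak_norm p _ <= _)%E; apply/funext => j; rewrite ofreal0 scale0r.
have W0 : (0 <= wmid_norm p T)%E.
  apply: le_trans (mid_norm_ge0 (T \o (fun=> 0%R : X))) _.
  by apply: ereal_sup_ubound; exists (fun=> 0%R : X) => //=; apply: le_trans xz0 _; rewrite lee_fin.
have [d d0 dT] := hT.2 (fun=> 0%R) (le_lt_trans xz0 (ltry _)) 1 ltr01.
(* Scaling by half of [d] brings the closed unit ball strictly inside the ball of radius [d]. *)
have d2 : 0 < d / 2 by exact: divr_gt0.
have WC : (wmid_norm p T <= ((d / 2)^-1 * 1)%:E)%E.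
  apply: ge_ereal_sup => _ [x /= x1 <-].
  pose x' j := ofreal k (d / 2) *: x j.
  have x'w : (weak_norm p x' <= (d / 2 * 1)%:E)%E.
    by apply: weak_norm_scale => //; exact: ltW.
  have := dT x' (le_lt_trans x'w (ltry _)).
  under [X in weak_norm _ X]funext do rewrite subr0.
  move=> /(_ (le_lt_trans x'w _))/ltW h.
  have h' : (mid_norm p (T \o x') <= 1)%E.
    have -> : T \o x' = (fun j => T (x' j) - T 0) by apply/funext => j /=; rewrite linear0 subr0.
    by apply: h; rewrite lte_fin mulr1 ltr_pdivrMr// mulr2n; lra.
  have di : 0 <= (d / 2)^-1 by rewrite invr_ge0 ltW.
  have := mid_norm_scale p1 di ler01 h'.
  congr (mid_norm p _ <= _)%E; apply/funext => j /=.
  by rewrite /x' linearZ /= scalerA -ofrealM mulVf ?ofreal1 ?scale1r ?gt_eqF.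
exists (fine (wmid_norm p T)); first by rewrite fine_ge0.
by rewrite fineK// ge0_fin_numE// (le_lt_trans WC)// ltry.
Qed.

(** Homogeneity gives the bound for every positive [v >= w]; taking [v = w + e] with [e] tending to
    0 includes [w = 0]. *)
Lemma wmid_norm_bound (C w : R) (x : nat -> X) : 0 <= C -> wmid_norm p T = C%:E ->
  0 <= w -> (weak_norm p x <= w%:E)%E -> (mid_norm p (T \o x) <= (C * w)%:E)%E.
Proof.
move=> C0 WC w0 xw.
have h (v : R) : 0 < v -> w <= v -> (mid_norm p (T \o x) <= (C * v)%:E)%E.
  move=> v0 wv; pose x' j := ofreal k v^-1 *: x j.
  have vi : 0 <= v^-1 by rewrite invr_ge0 ltW.
  have x'1 : (weak_norm p x' <= 1)%E.
    apply: le_trans (weak_norm_scale p1 vi w0 xw) _.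
    by rewrite lee_fin ler_pdivrMl// mulr1.
  have h' : (mid_norm p (T \o x') <= C%:E)%E.
    by rewrite -WC; apply: ereal_sup_ubound; exists x'.
  have := mid_norm_scale p1 (ltW v0) C0 h'; rewrite mulrC.
  congr (mid_norm p _ <= _)%E; apply/funext => j /=.
  by rewrite /x' linearZ /= scalerA -ofrealM mulfV ?ofreal1 ?scale1r ?gt_eqF.
have m0 := mid_norm_ge0 (T \o x).
have [w1 ww1] : 0 < w + 1 /\ w <= w + 1 by split; lra.
have mE : mid_norm p (T \o x) = (fine (mid_norm p (T \o x)))%:E.
  by rewrite fineK// ge0_fin_numE// (le_lt_trans (h _ w1 ww1))// ltry.
rewrite mE lee_fin; apply: le_mul_eps => // e e0.
by rewrite -lee_fin -mE; apply: h; lra.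
Qed.

(** In each representation of a tensor, the images [T (x j)] divided by [C * w] form an admissible
    test sequence for the dual mid norm of the second factors. *)
Lemma weakly_mid_summing_alpha_bound (C : R) : weakly_mid_summing p T ->
  0 <= C -> wmid_norm p T = C%:E -> alpha_bound p Phi C.
Proof.
move=> hT C0 WC.
have rep (s : seq (X * Y)) : ((rnorm (\sum_(q <- s) T q.1 q.2))%:E <=
    C%:E * (weak_norm p (fun j => nth 0%R (map fst s) j) *
            middual_norm p (fun j => nth 0%R (map snd s) j)))%E.
  set x := fun j => nth 0%R (map fst s) j; set y := fun j => nth 0%R (map snd s) j.
  have [w' w'0 xw'] := finite_weak_norm (map fst s) p1.
  have xoo : in_lpw p x := le_lt_trans xw' (ltry _).
  have [w w0 wE] := weak_norm_real xoo.
  have xw : (weak_norm p x <= w%:E)%E by rewrite wE.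
  have Tx := wmid_norm_bound C0 WC w0 xw.
  have Txin := hT.1 x xoo.
  pose S := \sum_(0 <= j < size s) rnorm (T (x j) (y j)).
  have sS : rnorm (\sum_(q <- s) T q.1 q.2) <= S.
    rewrite (big_nth (0, 0)); apply: le_trans (ler_rnorm_sum _ _ _) _.
    rewrite le_eqVlt; apply/orP; left; apply/eqP; apply: eq_big_nat => j /andP[_ js].
    by rewrite /x /y (nth_map (0, 0))// (nth_map (0, 0)).
  rewrite wE muleA -EFinM.
  (* If [C * w = 0], the right side is 0 even against an infinite dual mid norm, so the left side
     has to vanish: every [T (x j)] is 0. *)
  have [m0|mn0] := eqVneq (C * w) 0.
    rewrite m0 mul0e lee_fin (le_trans sS)// /S big1// => j _.
    have : rnorm (T (x j)) <= 0.
      by have := mid_norm_coord p1 (mulr_ge0 C0 w0) Tx j; rewrite m0.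
    move=> Tx0; have /rnorm_eq0 -> : rnorm (T (x j)) = 0.
      by apply/eqP; rewrite eq_le Tx0 rnorm_ge0.
    by rewrite dual0 rnorm0.
  have mp : 0 < C * w by rewrite lt_neqAle eq_sym mn0 mulr_ge0.
  have mi : 0 <= (C * w)^-1 by rewrite invr_ge0 ltW.
  apply: (@le_trans _ _ S%:E); first by rewrite lee_fin.
  rewrite -lee_pdivrMl//.
  apply: (@le_trans _ _ (\sum_(0 <= j <oo) (rnorm ((ofreal k (C * w)^-1 *: T (x j)) (y j)))%:E)%E).
    rewrite -EFinM /S mulr_sumr.
    under eq_bigr => j _.
      rewrite -(@rnormZr R k K^o)//; over.
    rewrite -sumEFin; apply: nneseries_lim_ge => j _ _.
    by rewrite lee_fin rnorm_ge0.
  apply: ereal_sup_ubound; exists (fun j => ofreal k (C * w)^-1 *: T (x j)) => //; split.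
    exact: in_lpmid_scale.
  have := mid_norm_scale p1 mi (ltW mp) Tx; rewrite mulVf//.
split=> // u; have [s us] := tensor_spanned u.
(* A positive [C] can be moved across the infimum; for [C = 0] one representation already gives the
   value 0. *)
have [Cz|Cn0] := eqVneq C 0.
  by rewrite {1}us functional_of_sum Cz mul0e; have := rep s; rewrite Cz mul0e.
have Cp : 0 < C by rewrite lt_neqAle eq_sym Cn0.
rewrite -lee_pdivrMl//; apply: le_ereal_inf_tmp => _ [s' /= us' <-].
by rewrite lee_pdivrMl// us' functional_of_sum.
Qed.

End representation.

Theorem theorem2p4 (R : realType) (k : scalars)
  (X Y : completeNormedModType (scalar_field R k))
  (p : \bar R) (hp : (1 <= p)%E)
  (T : {linear X -> dual Y}) (hT : continuous T) :
  (alpha_bounded p (functional_of T) <-> weakly_mid_summing p T) /\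
  (weakly_mid_summing p T ->
     alpha_dual_norm p (functional_of T) = wmid_norm p T).
Proof.
split; first split=> [[C PC]|wT].
- exact: (mid_bound_weakly_mid_summing PC.1 (alpha_bound_mid_bound hp PC)).1.
- have [C C0 WC] := wmid_norm_fin hp wT.
  by exists C; exact: weakly_mid_summing_alpha_bound.
move=> wT; have [C C0 WC] := wmid_norm_fin hp wT.
(* The weak mid norm is itself an admissible constant for the functional, and every admissible
   constant dominates it. *)
apply/eqP; rewrite eq_le; apply/andP; split.
  rewrite WC; apply: ereal_inf_lbound; exists C => //.
  exact: weakly_mid_summing_alpha_bound.
apply: le_ereal_inf_tmp => _ [C' PC' <-].
exact: (mid_bound_weakly_mid_summing PC'.1 (alpha_bound_mid_bound hp PC')).2.
Qed.
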